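(* Let $k$ be an uncountable algebraically closed field and let $t\ge 2$. Let $y_1,\dots,y_t$ be the coordinates on $\mathbb{A}^t=\mathbb{A}^t_k$ and let $V_i=\{y_i=0\}\subseteq\mathbb{A}^t$. There is a generic subset $Y\subseteq\mathbb{A}^t\setminus\bigcup_{i=1}^t V_i$ such that if $(p_1,\dots,p_t)\in Y$ then $R=k\langle D_{p_1},D_{p_2},\dots,D_{p_t}\rangle$ is noetherian.
   Context: Fix the Laurent polynomial algebra $k[y^{\pm1}]$. For $p\in k\setminus\{0,1\}$, the Eulerian derivative $D_p\in\operatorname{End}_k k[y^{\pm1}]$ is $f(y)\mapsto \frac{f(py)-f(y)}{py-y}$; for $p=1$, $D_1$ is $f\mapsto df/dy$. $k\langle D_{p_1},\dots,D_{p_t}\rangle$ denotes the $k$-subalgebra of $\operatorname{End}_k k[y^{\pm1}]$ generated by the $D_{p_i}$. ''Noetherian'' means left and right noetherian. A subset of a variety $X$ is generic if its complement in $X$ is contained in a countable union of proper closed subvarieties of $X$. *)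

(* Defs.v *)
From HB Require Import structures.
From mathcomp Require Import all_boot all_order all_algebra.
From mathcomp Require Import finmap.
From mathcomp Require Import boolp classical_sets functions cardinality.
From mathcomp.multinomials Require Import mpoly.

Set Implicit Arguments.
Unset Strict Implicit.
Unset Printing Implicit Defensive.

Import GRing.Theory.

Local Open Scope classical_set_scope.
Local Open Scope ring_scope.

(* Subvarieties of a locally closed subset X of the affine space A^t, whose    *)
(* points are the functions 'I_t -> k; X carries the induced Zariski topology. *)
Section Generic.
Variables (k : closedFieldType) (t : nat).
Implicit Types X Y Z : set ('I_t -> k).

Definition zero_locus (S : set {mpoly k[t]}) : set ('I_t -> k) :=
  [set v | forall f, S f -> f.@[v] = 0].

Definition closed_subvariety X Z := exists S, Z = X `&` zero_locus S.

Definition proper_closed_subvariety X Z := closed_subvariety X Z /\ Z <> X.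

Definition generic X Y := Y `<=` X /\
  exists Z : nat -> set ('I_t -> k),
    (forall n, proper_closed_subvariety X (Z n)) /\ X `\` Y `<=` \bigcup_n Z n.

Definition coord_hyperplane (i : 'I_t) : set ('I_t -> k) := [set v | v i = 0].

End Generic.

Arguments coord_hyperplane k {t} i.

(* mpoly and monalg both define the notation {mpoly _[_]}; from here on it no  *)
(* longer denotes the type used in Generic.                                    *)
From mathcomp.multinomials Require Import monalg.

(* The Laurent polynomial algebra k[y, y^-1], carried by the finitely          *)
(* supported families of coefficients int -> k. The ring structure of monalg   *)
(* is not available for it, because its exponents must form a monoid without   *)
(* non-trivial units.                                                          *)
Definition laurent (k : comNzRingType) : Type := {malg k[int]}.

HB.instance Definition _ (k : comNzRingType) :=
  GRing.Lmodule.copy (laurent k) {malg k[int]}.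

Section LaurentRing.
Variable k : comNzRingType.
Implicit Types f g h : laurent k.

Local Notation "f1 *M_[ m , n ] f2" :=
  (<< mcoeff m f1 * mcoeff n f2 *g (m + n)%R >> : laurent k)
  (at level 40, no associativity).

Definition lmul f g : laurent k :=
  \sum_(m <- msupp f) \sum_(n <- msupp g) (f *M_[m, n] g).

Definition lone : laurent k := << 1 *g 0%R >>.

Lemma lmulw (d1 d2 : {fset int}) f g :
  (msupp f `<=` d1)%fset -> (msupp g `<=` d2)%fset ->
  lmul f g = \sum_(m <- d1) \sum_(n <- d2) (f *M_[m, n] g).
Proof.
move=> le1 le2; rewrite /lmul (big_fset_incl _ le1) /=.
  apply: eq_bigr => m _; apply: big_fset_incl => // n _ /mcoeff_outdom ->.
  by rewrite mulr0 monalgU0.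
move=> m _ /mcoeff_outdom f0.
by rewrite big1 // => n _; rewrite f0 mul0r monalgU0.
Qed.

Lemma lmulC : commutative lmul.
Proof.
move=> f g; rewrite /lmul exchange_big /=; apply: eq_bigr => n _.
by apply: eq_bigr => m _; rewrite mulrC addrC.
Qed.

Lemma lmulDl : left_distributive lmul +%R.
Proof.
move=> f g h.
rewrite (lmulw (msuppD_le _ _) (fsubset_refl _)).
rewrite (lmulw (fsubsetUl _ (msupp g)) (fsubset_refl (msupp h))).
rewrite (lmulw (fsubsetUr (msupp f) _) (fsubset_refl (msupp h))).
rewrite -big_split /=; apply: eq_bigr => m _.
rewrite -big_split /=; apply: eq_bigr => n _.
by rewrite mcoeffD mulrDl monalgUD.
Qed.

Lemma lmulDr : right_distributive lmul +%R.
Proof. by move=> f g h; rewrite lmulC lmulDl !(lmulC f). Qed.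

Lemma lmul0l : left_zero 0 lmul.
Proof. by move=> f; rewrite /lmul msupp0 big_seq_fset0. Qed.

Lemma lmul0r : right_zero 0 lmul.
Proof. by move=> f; rewrite lmulC lmul0l. Qed.

Lemma lmulUU (a b : k) (m n : int) :
  lmul << a *g m >> << b *g n >> = << a * b *g (m + n)%R >>.
Proof. by rewrite (lmulw msuppU_le msuppU_le) !big_seq_fset1 !mcoeffUU. Qed.

Lemma lmul_suml (I : Type) (r : seq I) (F : I -> laurent k) g :
  lmul (\sum_(i <- r) F i) g = \sum_(i <- r) lmul (F i) g.
Proof. exact: (big_morph (lmul^~ g) (fun _ _ => lmulDl _ _ _) (lmul0l g)). Qed.

Lemma lmul_sumr (I : Type) (r : seq I) (F : I -> laurent k) f :
  lmul f (\sum_(i <- r) F i) = \sum_(i <- r) lmul f (F i).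
Proof. exact: (big_morph (lmul f) (fun _ _ => lmulDr _ _ _) (lmul0r f)). Qed.

Lemma lmulA : associative lmul.
Proof.
move=> f g h; rewrite (monalgE f) (monalgE g) (monalgE h).
move: (msupp f : seq int) (msupp g : seq int) (msupp h : seq int) => r1 r2 r3.
rewrite !(lmul_suml r1); apply: eq_bigr => l _.
rewrite (lmul_suml r2) !(lmul_sumr r2) (lmul_suml r2); apply: eq_bigr => m _.
rewrite !(lmul_sumr r3); apply: eq_bigr => n _.
by rewrite !lmulUU mulrA addrA.
Qed.

Lemma lmul1l : left_id lone lmul.
Proof.
move=> f; rewrite (monalgE f) lmul_sumr; apply: eq_bigr => n _.
by rewrite lmulUU mul1r add0r.
Qed.

Lemma lone_neq0 : lone != 0.
Proof. by rewrite monalgU_eq0 oner_eq0. Qed.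

HB.instance Definition _ :=
  GRing.Zmodule_isComNzRing.Build (laurent k) lmulA lmulC lmul1l lmulDl lone_neq0.

Lemma lscalerAl (a : k) f g : a *: (f * g) = (a *: f) * g.
Proof.
have scaleU b n (c : k) : c *: (<< b *g n >> : laurent k) = << c * b *g n >>.
  by apply/malgP => i; rewrite mcoeffZ !mcoeffU mulrnAr.
have {1}-> : f * g = \sum_(m <- msupp f) \sum_(n <- msupp g) (f *M_[m, n] g) by [].
rewrite [RHS](lmulw (msuppZ_le _ _) (fsubset_refl _)).
rewrite scaler_sumr; apply: eq_bigr => m _.
rewrite scaler_sumr; apply: eq_bigr => n _.
by rewrite scaleU mcoeffZ mulrA.
Qed.

HB.instance Definition _ :=
  GRing.Lmodule_isLalgebra.Build k (laurent k) lscalerAl.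
HB.instance Definition _ := GRing.Lalgebra_isComAlgebra.Build k (laurent k).

End LaurentRing.

Section Eulerian.
Variable k : fieldType.
Implicit Types (f g : laurent k) (p : k).

(* y ^ n *)
Definition ymon (n : int) : laurent k := << 1 *g n >>.

Lemma ymonD (m n : int) : ymon (m + n) = ymon m * ymon n.
Proof. by rewrite [RHS]lmulUU mulr1. Qed.

Lemma ymon0 : ymon 0 = 1.
Proof. by []. Qed.

(* f(y) |-> f(py), for p != 0 *)
Definition ysubst p f : laurent k := \sum_(n <- msupp f) mcoeff n f *: (p ^ n *: ymon n).

(* f |-> df/dy *)
Definition yderiv f : laurent k := \sum_(n <- msupp f) mcoeff n f *: (n%:~R *: ymon (n - 1)).

(* The inverse of py - y = (p - 1) y in k[y, y^-1] is (p - 1)^-1 y^-1.         *)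
Definition eulerian p f : laurent k :=
  if p == 1 then yderiv f else ((p - 1)^-1 *: ymon (- 1)) * (ysubst p f - f).

(* For p != 1, eulerian p f is the quotient (f(py) - f(y)) / (py - y). *)
Lemma eulerianE p f : p != 1 ->
  (p *: ymon 1 - ymon 1) * eulerian p f = ysubst p f - f.
Proof.
move=> p1; rewrite /eulerian (negPf p1) mulrA.
have -> : p *: ymon 1 - ymon 1 = (p - 1) *: ymon 1 by rewrite scalerBl scale1r.
rewrite -scalerAl -scalerAr scalerA -ymonD ymon0 divff ?subr_eq0 //.
by rewrite scale1r mul1r.
Qed.

Lemma monomial_map_linear (c : int -> k) (s : int -> int) :
  linear (fun f : laurent k =>
    \sum_(n <- msupp f) mcoeff n f *: (c n *: ymon (s n)) : laurent k).
Proof.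
move=> a f g /=.
pose F h n := mcoeff n h *: (c n *: ymon (s n)).
have wide (d : {fset int}) (h : laurent k) : (msupp h `<=` d)%fset ->
    \sum_(n <- msupp h) F h n = \sum_(n <- d) F h n.
  move=> le; apply: big_fset_incl => // n _ /mcoeff_outdom h0.
  by rewrite /F h0 scale0r.
pose d := (msupp f `|` msupp g)%fset.
rewrite (wide d f) ?fsubsetUl // (wide d g) ?fsubsetUr // (wide d).
  rewrite scaler_sumr -big_split /=; apply: eq_bigr => n _.
  by rewrite /F mcoeffD mcoeffZ scalerDl !scalerA.
apply: (fsubset_trans (msuppD_le _ _)).
by rewrite fsetSU // msuppZ_le.
Qed.

Lemma eulerian_linear p : linear (eulerian p).
Proof.
move=> a f g; rewrite /eulerian; case: eqP => _.
  exact: monomial_map_linear.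
rewrite scalerAr -mulrDr; congr (_ * _).
rewrite [ysubst _ _](@monomial_map_linear (fun n => p ^ n) id).
by rewrite scalerBr opprD addrACA.
Qed.

HB.instance Definition _ p :=
  GRing.isLinear.Build k (laurent k) (laurent k) *:%R (eulerian p)
    (eulerian_linear p).

End Eulerian.

(* End_k A, the k-linear endomorphisms of A; the product is composition.       *)
Definition endo (k : comNzRingType) (A : lalgType k) : Type := {linear A -> A}.

Section EndoAlgebra.
Variables (k : comNzRingType) (A : lalgType k).

HB.instance Definition _ := gen_eqMixin (endo A).
HB.instance Definition _ := gen_choiceMixin (endo A).

Definition endo_fun (u : endo A) : A -> A := GRing.Linear.sort u.
Coercion endo_fun : endo >-> Funclass.

Implicit Types (u v w : endo A) (a : k).

Lemma endoP u v : u =1 v -> u = v.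
Proof.
case: u v => [f [[mf] [lf]]] [g [[mg] [lg]]] /funext /= fg.
move: mf lf mg lg; rewrite /endo_fun /= in fg; rewrite fg => mf lf mg lg.
by rewrite (Prop_irrelevance mf mg) (Prop_irrelevance lf lg).
Qed.

Definition endo0 : endo A := \0 : {linear A -> A}.
Definition endoN u : endo A := (\- (u : {linear A -> A}))%R : {linear A -> A}.
Definition endoD u v : endo A :=
  ((u : {linear A -> A}) \+ (v : {linear A -> A}))%R : {linear A -> A}.
Definition endo1 : endo A := idfun : {linear A -> A}.
Definition endoM u v : endo A :=
  ((u : {linear A -> A}) \o (v : {linear A -> A}))%R : {linear A -> A}.
Definition endoZ a u : endo A := (a \*: (u : {linear A -> A}))%R : {linear A -> A}.

Fact endo_addA : associative endoD.
Proof. by move=> u v w; apply: endoP => x; apply: addrA. Qed.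
Fact endo_addC : commutative endoD.
Proof. by move=> u v; apply: endoP => x; apply: addrC. Qed.
Fact endo_add0 : left_id endo0 endoD.
Proof. by move=> u; apply: endoP => x; apply: add0r. Qed.
Fact endo_addN : left_inverse endo0 endoN endoD.
Proof. by move=> u; apply: endoP => x; apply: addNr. Qed.

HB.instance Definition _ :=
  GRing.isZmodule.Build (endo A) endo_addA endo_addC endo_add0 endo_addN.

Fact endo_mulA : associative endoM.
Proof. by move=> u v w; apply: endoP. Qed.
Fact endo_mul1l : left_id endo1 endoM.
Proof. by move=> u; apply: endoP. Qed.
Fact endo_mul1r : right_id endo1 endoM.
Proof. by move=> u; apply: endoP. Qed.
Fact endo_mulDl : left_distributive endoM +%R.
Proof. by move=> u v w; apply: endoP. Qed.
Fact endo_mulDr : right_distributive endoM +%R.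
Proof. by move=> u v w; apply: endoP => x; apply: raddfD. Qed.
Fact endo_1_neq0 : endo1 != 0.
Proof.
apply/eqP => /(congr1 (fun u : endo A => u 1)) e10.
by have := oner_neq0 A; rewrite -[X in X != _]/(endo1 1) e10 eqxx.
Qed.

HB.instance Definition _ := GRing.Zmodule_isNzRing.Build (endo A)
  endo_mulA endo_mul1l endo_mul1r endo_mulDl endo_mulDr endo_1_neq0.

Fact endo_scaleA a b u : endoZ a (endoZ b u) = endoZ (a * b) u.
Proof. by apply: endoP => x; apply: scalerA. Qed.
Fact endo_scale1 : left_id 1 endoZ.
Proof. by move=> u; apply: endoP => x; apply: scale1r. Qed.
Fact endo_scaleDr : right_distributive endoZ +%R.
Proof. by move=> a u v; apply: endoP => x; apply: scalerDr. Qed.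
Fact endo_scaleDl u : {morph endoZ^~ u : a b / a + b}.
Proof. by move=> a b; apply: endoP => x; apply: scalerDl. Qed.

HB.instance Definition _ := GRing.Zmodule_isLmodule.Build k (endo A)
  endo_scaleA endo_scale1 endo_scaleDr endo_scaleDl.

Fact endo_scaleAl a u v : a *: (u * v) = (a *: u) * v.
Proof. by apply: endoP. Qed.
Fact endo_scaleAr a u v : a *: (u * v) = u * (a *: v).
Proof. by apply: endoP => x; apply/esym/linearZ. Qed.

HB.instance Definition _ :=
  GRing.Lmodule_isLalgebra.Build k (endo A) endo_scaleAl.
HB.instance Definition _ :=
  GRing.Lalgebra_isAlgebra.Build k (endo A) endo_scaleAr.

End EndoAlgebra.

Definition eulerian_endo (k : fieldType) (p : k) : endo (laurent k) :=
  eulerian p : {linear laurent k -> laurent k}.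

(* The k-subalgebra of A generated by G, as a subset and as a type.            *)
Section Subalgebra.
Variables (k : comNzRingType) (A : algType k) (G : set A).

Definition gen_subalg : {pred A} := fun x =>
  `[< forall S : {pred A}, GRing.subalg_closed S -> (forall g, G g -> g \in S) ->
      x \in S >].

Lemma gen_subalgP x : reflect (forall S : {pred A}, GRing.subalg_closed S ->
  (forall g, G g -> g \in S) -> x \in S) (x \in gen_subalg).
Proof. exact: asboolP. Qed.

Fact gen_subalg_closed : GRing.subalg_closed gen_subalg.
Proof.
split.
- by apply/gen_subalgP => S [].
- move=> a x y /gen_subalgP xG /gen_subalgP yG.
  by apply/gen_subalgP => S cS GS; case: (cS) => _ + _; apply; [apply: xG|apply: yG].
- move=> x y /gen_subalgP xG /gen_subalgP yG.
  by apply/gen_subalgP => S cS GS; case: (cS) => _ _; apply; [apply: xG|apply: yG].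
Qed.

HB.instance Definition _ :=
  GRing.isSubalgClosed.Build k A gen_subalg gen_subalg_closed.

Record subalg : Type := Subalg { subalg_val : A; _ : subalg_val \in gen_subalg }.

HB.instance Definition _ := [isSub for subalg_val].
HB.instance Definition _ := [Choice of subalg by <:].
HB.instance Definition _ := [SubChoice_isSubAlgebra of subalg by <:].

End Subalgebra.

Section Noetherian.
Variable R : nzRingType.
Implicit Type I : set R.

Definition left_ideal I :=
  [/\ I 0, forall x y, I x -> I y -> I (x + y) & forall a x, I x -> I (a * x)].

Definition right_ideal I :=
  [/\ I 0, forall x y, I x -> I y -> I (x + y) & forall a x, I x -> I (x * a)].

Definition left_noetherian := forall I : nat -> set R,
  (forall n, left_ideal (I n)) -> (forall n, I n `<=` I n.+1) ->
  exists N, forall n, (N <= n)%N -> I n = I N.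

Definition right_noetherian := forall I : nat -> set R,
  (forall n, right_ideal (I n)) -> (forall n, I n `<=` I n.+1) ->
  exists N, forall n, (N <= n)%N -> I n = I N.

Definition noetherian := left_noetherian /\ right_noetherian.

End Noetherian.

(* Main.v *)
Require Import Defs.
From HB Require Import structures.
From mathcomp Require Import all_boot all_order all_algebra.
From mathcomp Require Import finmap.
From mathcomp Require Import boolp classical_sets functions cardinality.
From mathcomp.multinomials Require Import mpoly.
From mathcomp Require Import ring zify.

Set Implicit Arguments.
Unset Strict Implicit.
Unset Printing Implicit Defensive.

Import Order.TTheory GRing.Theory.

Local Open Scope classical_set_scope.
Local Open Scope ring_scope.

(** The operator D_p sends y^n to (p^n - 1)/(p - 1) y^(n-1).  So an operator of
    degree -m in R sends y^n to f(p^n) y^(n-m), where p^n = (p_1^n, ..., p_t^n),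
    for a polynomial f in t variables of degree at most m.  Put c_j = p^j.
    Composing on the left with D_(p_i) multiplies f by a nonzero multiple of
    x_i - c_(m,i), a linear polynomial vanishing at c_m; hence f vanishes at
    c_0, ..., c_(m-1).  Composing on the right is described in the same way, with
    the points c_j = p^(-j-1), once the operator is written as
    y^n |-> f(p^(n-m)) y^(n-m).  An ideal is determined by the spaces A_m of
    leading coefficients of its elements, which satisfy L_m A_m <= A_(m+1) for
    L_m the space of linear polynomials vanishing at c_m.  So both chain
    conditions follow from one commutative statement, [moving_module_acc]: chains
    of such families (A_m), with A_m consisting of polynomials of degree at most m
    vanishing at c_0, ..., c_(m-1), stabilise.

    Two properties of the points are used.  A nonzero polynomial vanishes at only
    finitely many c_j ([critically_dense]), and large finite sets of points c_j
    impose independent conditions on the polynomials of degree somewhat less than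
    the number of points ([interpolating]); this is where t > 1 is needed.
    Moreover, for any l distinct points, the products of l linear polynomials, one
    vanishing at each point, span all polynomials of degree at most l vanishing
    at all the points ([vanish_linear_products]).  Hence a in A_m implies
    w a in A_(m+l) for every w of degree at most l vanishing at
    c_m, ..., c_(m+l-1).

    Now fix a nonzero f in some A_d.  By the modular law, (A_m) is controlled by
    its image modulo the multiples of f and by its intersection with them.  Modulo
    multiples of f, every polynomial of large degree l can be changed to vanish at
    c_m, ..., c_(m+l-1), because f is nonzero at these points for large m; so the
    image is, in large degrees, stable under multiplication by all polynomials of
    large degree, and Dickson's lemma, applied to leading monomials, gives
    stability ([quotient_stab]).  A multiple f h in A_m is determined, modulo known
    elements of A_m, by the values of h at the finitely many points where f
    vanishes, which leaves a chain in a finite-dimensional space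
    ([multiples_stab]).

    The points behave as required as soon as certain determinants, one for each
    bound b and each (b+1)^t distinct exponents n_j, do not vanish at p: their
    entries are the values at p^(n_j) of the monomials of degree at most b in each
    variable.  These are countably many polynomials in p, and none of them
    vanishes identically on the torus: at p_i = q^((b+1)^i) they become
    Vandermonde determinants ([general_position_generic]). *)

(** * Subspaces and ascending chains *)

Definition subspace (k : fieldType) (V : lmodType k) (U : set V) :=
  U 0 /\ forall a x y, U x -> U y -> U (a *: x + y).

Section Subspace.
Variables (k : fieldType) (V : lmodType k).
Implicit Types (U W : set V).

Lemma subspace0 U : subspace U -> U 0. Proof. by case. Qed.

Lemma subspaceZ U a x : subspace U -> U x -> U (a *: x).
Proof. by case=> U0 cU Ux; rewrite -[_ *: _]addr0; apply: cU. Qed.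

Lemma subspaceD U x y : subspace U -> U x -> U y -> U (x + y).
Proof. by case=> U0 cU Ux Uy; rewrite -[x]scale1r; apply: cU. Qed.

Lemma subspaceB U x y : subspace U -> U x -> U y -> U (x - y).
Proof.
by move=> sU Ux Uy; apply: subspaceD => //; rewrite -scaleN1r; apply: subspaceZ.
Qed.

Lemma subspace_sum U (I : Type) (r : seq I) (P : pred I) (F : I -> V) :
  subspace U -> (forall i, P i -> U (F i)) -> U (\sum_(i <- r | P i) F i).
Proof.
move=> sU UF; elim/big_ind: _ => //; first exact: subspace0.
by move=> x y; apply: subspaceD.
Qed.

End Subspace.

Lemma chain_subset (T : Type) (U : nat -> set T) :
  (forall i, U i `<=` U i.+1) -> forall i j, (i <= j)%N -> U i `<=` U j.
Proof.
move=> UU i j /subnK <-; elim: (j - i)%N => // n IH.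
by apply: subset_trans IH _; rewrite addSn.
Qed.

(** Induction on the number of functionals: the first one either vanishes on all
    the subspaces, or it can be cleared from every vector of the chain by
    subtracting a multiple of one fixed vector. *)
Lemma findim_acc (k : fieldType) (V : lmodType k) (I : eqType) (s : seq I)
    (phi : I -> V -> k) (U : nat -> set V) :
  (forall e, scalar (phi e)) -> (forall i, subspace (U i)) ->
  (forall i, U i `<=` U i.+1) ->
  (forall i j x, U j x -> (forall e, e \in s -> phi e x = 0) -> U i x) ->
  exists N, forall i, U i `<=` U N.
Proof.
move=> lin; elim: s U => [|e s IH] U subU UU ker.
  by exists 0%N => i x Ux; apply: ker Ux _.
have phi0 : phi e 0 = 0 by have := lin e (-1) 0 0; rewrite scaler0 addr0 mulN1r addNr.
have phiB a x y : phi e (x - a *: y) = phi e x - a * phi e y.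
  by rewrite addrC -scaleNr lin mulNr addrC.
have [|||N UN] := IH (fun i => U i `&` [set x | phi e x = 0]).
- move=> i; split; first by split; [exact: subspace0|].
  move=> a x y [Ux x0] [Uy y0]; split; first by case: (subU i) => _; apply.
  by rewrite /= lin x0 y0 mulr0 addr0.
- by move=> i x [Ux x0]; split=> //; apply: UU.
- move=> i j x [Ux x0] sx; split=> //; apply: ker Ux _.
  by move=> d; rewrite in_cons => /predU1P[->|/sx].
have [[M [u [Uu u0]]]|none] := pselect (exists M u, U M u /\ phi e u != 0).
  exists (maxn N M) => i x Ux.
  set y := x - (phi e x / phi e u) *: u.
  have Uy : U (maxn N M) y.
    apply: (chain_subset UU (leq_maxl N M)).
    suff /UN[] : (U (maxn i M) `&` [set x | phi e x = 0]) y by [].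
    split; last by rewrite /= phiB divfK ?subrr.
    apply: subspaceB => //; first exact: chain_subset UU _ _ (leq_maxl _ _) _ Ux.
    by apply: subspaceZ => //; apply: chain_subset UU _ _ (leq_maxr _ _) _ Uu.
  rewrite -[x](subrK ((phi e x / phi e u) *: u)).
  apply: subspaceD => //; apply: subspaceZ => //.
  exact: chain_subset UU _ _ (leq_maxr _ _) _ Uu.
exists N => i x Ux; suff /UN[] : (U i `&` [set x | phi e x = 0]) x by [].
by split=> //; apply: contrapT => /eqP x0; apply: none; exists i, x.
Qed.

(** * Dickson's lemma *)

(** Each index is chosen to minimise [f] among the indices after the previous one. *)
Lemma nondecreasing_subsequence (f : nat -> nat) :
  exists2 g : nat -> nat, {homo g : i j / (i < j)%N} &
    {homo f \o g : i j / (i <= j)%N}.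
Proof.
have ex_argmin n : exists l, (n < l)%N /\ forall j, (n < j)%N -> (f l <= f j)%N.
  have ex : exists v, `[< exists2 j, (n < j)%N & f j = v >].
    by exists (f n.+1); apply/asboolP; exists n.+1.
  case: (ex_minnP ex) => v /asboolP[j nj <-] jmin; exists j; split=> // l nl.
  by apply: jmin; apply/asboolP; exists l.
have [m mP] := choice ex_argmin.
pose g i := iter i m (m 0%N).
have g_lt i : (g i < g i.+1)%N by case: (mP (g i)).
exists g; first by apply: homo_ltn g_lt; apply: ltn_trans.
have g_min i : exists l, g i = m l /\ (l < g i)%N.
  by case: i => [|i]; [exists 0%N|exists (g i)]; split=> //; case: (mP 0%N).
apply: homo_leq => [//||i]; first exact: leq_trans.
have [l [gE lg]] := g_min i; rewrite /= {1}gE.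
by case: (mP l) => _; apply; apply: ltn_trans lg (g_lt i).
Qed.

Lemma dickson (I : eqType) (s : seq I) (u : I -> nat -> nat) :
  exists i j, (i < j)%N /\ forall e, e \in s -> (u e i <= u e j)%N.
Proof.
suff [g g_incr gP] : exists2 g : nat -> nat, {homo g : i j / (i < j)%N} &
    forall e, e \in s -> {homo u e \o g : i j / (i <= j)%N}.
  exists (g 0%N), (g 1%N); split; first exact: g_incr.
  by move=> e /gP; apply.
elim: s => [|e s [g g_incr gP]]; first by exists id.
have [h h_incr hP] := nondecreasing_subsequence (u e \o g).
exists (g \o h) => [i j ij|d]; first by apply: g_incr; apply: h_incr.
rewrite in_cons => /predU1P[->|/gP ug] i j ij; first exact: hP.
by apply: ug; case: (ltngtP i j) ij => // [/h_incr/ltnW|-> _].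
Qed.

(** * Polynomials of bounded degree vanishing at points *)

Section BoundedDegree.
Variables (k : fieldType) (t : nat).
Implicit Types (f g : {mpoly k[t]}) (v : 'I_t -> k).

Definition deg_lt d : set {mpoly k[t]} := [set f | (msize f <= d)%N].
Definition deg_le d := deg_lt d.+1.

Lemma deg_lt_subspace d : subspace (deg_lt d).
Proof.
split=> [|a f g]; rewrite /deg_lt /= ?msize0 // => df dg.
by apply: leq_trans (msizeD_le _ _) _; rewrite geq_max dg (leq_trans (msizeZ_le _ _)).
Qed.

Lemma deg_le_subspace d : subspace (deg_le d).
Proof. exact: deg_lt_subspace. Qed.

Lemma deg_leW d e : (d <= e)%N -> deg_le d `<=` deg_le e.
Proof. by move=> de f /leq_trans; apply. Qed.

Lemma deg_leM d e f g : deg_le d f -> deg_le e g -> deg_le (d + e) (f * g).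
Proof.
rewrite /deg_le /deg_lt /=; have [->|f0] := eqVneq f 0; first by rewrite mul0r msize0.
have [->|g0] := eqVneq g 0; first by rewrite mulr0 msize0.
rewrite msizeM // => df dg; rewrite -ltnS prednK; first by rewrite -addSn -addnS leq_add.
by rewrite addn_gt0 lt0n msize_poly_eq0 f0.
Qed.

Lemma deg_leC d a : deg_le d a%:MP.
Proof. by rewrite /deg_le /deg_lt /= msizeC; case: (a != 0). Qed.

Lemma deg_leX d m : deg_le d 'X_[m] = (mdeg m <= d)%N :> Prop.
Proof. by rewrite /deg_le /deg_lt /= msizeX. Qed.

Definition shift_var v (i : 'I_t) : {mpoly k[t]} := 'X_i - (v i)%:MP.

Lemma deg_le_shift_var v i : deg_le 1 (shift_var v i).
Proof.
apply: subspaceB (deg_le_subspace 1) _ (deg_leC _ _).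
by rewrite deg_leX mdeg1.
Qed.

Lemma meval_shift_var u v i : (shift_var v i).@[u] = u i - v i.
Proof. by rewrite mevalB mevalXU mevalC. Qed.

(** A monomial [x_i m] is [(x_i - v_i) m + v_i m], which reduces the claim to the
    monomials of smaller degree. *)
Lemma taylor1 v d f : deg_le d f ->
  exists2 a : 'I_t -> {mpoly k[t]}, (forall i, deg_lt d (a i)) &
    f = (f.@[v])%:MP + \sum_i shift_var v i * a i.
Proof.
pose Q d : set {mpoly k[t]} := [set f |
  exists2 a : 'I_t -> {mpoly k[t]}, (forall i, deg_lt d (a i)) &
    f = (f.@[v])%:MP + \sum_i shift_var v i * a i].
have subQ e : subspace (Q e).
  split=> [|c g h [a da gE] [b db hE]].
    exists (fun=> 0) => [i|]; first by apply: subspace0; apply: deg_lt_subspace.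
    by rewrite meval0 big1 ?addr0 // => i _; rewrite mulr0.
  exists (fun i => c *: a i + b i); first by move=> i; apply: (deg_lt_subspace e).2.
  under eq_bigr do rewrite mulrDr -scalerAr.
  rewrite big_split /= -scaler_sumr {1}gE {1}hE.
  by rewrite mevalD mevalZ mpolyCD mpolyCM mul_mpolyC scalerDr addrACA.
have QX e m : (mdeg m <= e)%N -> Q e 'X_[m].
  elim: e m => [|e IH] m me; have [->|m0] := eqVneq m 0%MM.
  1,3: exists (fun=> 0) => [i|]; first by apply: subspace0; apply: deg_lt_subspace.
  1,2: by rewrite mpolyX0 meval1 big1 ?addr0 // => i _; rewrite mulr0.
    by move: me; rewrite leqn0 mdeg_eq0 (negPf m0).
  have [i mi] : exists i, m i != 0%N.
    apply: contrapT => none; case/eqP: m0; apply/mnmP => i; rewrite mnm0E.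
    by apply/eqP; apply: contrapT => /negP mi; apply: none; exists i.
  move: mi me; rewrite -lep1mP => /submK <-; move: (m - U_(i))%MM => n.
  rewrite mdegD mdeg1 addn1 ltnS addmC => ne.
  have [a da aE] := IH n ne.
  exists (fun j => v i *: a j + (j == i)%:R *: 'X_[n]) => [j|].
    apply: (deg_lt_subspace _).2; first exact: leqW (da j).
    by apply: subspaceZ; [exact: deg_lt_subspace|rewrite /deg_lt /= msizeX].
  under eq_bigr do rewrite mulrDr -scalerAr.
  rewrite big_split /= -scaler_sumr [X in _ + (_ + X)](bigD1 i) //=.
  rewrite eqxx scale1r [X in _ + (_ + (_ + X))]big1.
    rewrite addr0 mpolyXD mevalM mevalXU mpolyCM addrA mul_mpolyC -scalerDr -aE.
    by rewrite -mul_mpolyC -mulrDl addrC subrK.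
  by move=> j /negPf ->; rewrite scale0r mulr0.
rewrite /deg_le /deg_lt /= => df; rewrite [f]mpolyE big_seq.
apply: (subspace_sum (U := Q d)) => //.
move=> m /msize_mdeg_lt mf; apply: subspaceZ => //; apply: QX.
by rewrite -ltnS (leq_trans mf).
Qed.

End BoundedDegree.

Arguments deg_lt_subspace {k t} d.
Arguments deg_le_subspace {k t} d.

Section Points.
Variables (k : fieldType) (t : nat) (T : eqType) (c : T -> 'I_t -> k).
Implicit Types (f g : {mpoly k[t]}) (s : seq T).

Definition vanish_on s : set {mpoly k[t]} := [set f | forall j, j \in s -> f.@[c j] = 0].

Lemma vanish_on_subspace s : subspace (vanish_on s).
Proof.
split=> [j _|a f g f0 g0 j js]; first by rewrite meval0.
by rewrite mevalD mevalZ f0 // g0 // mulr0 addr0.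
Qed.

(** The component of degree [size s] of the product of the homogeneous ideals of
    the points [c j], in dehomogenised form. *)
Fixpoint linear_products s : set {mpoly k[t]} :=
  if s is j :: s' then
    [set f | exists2 g : 'I_t -> {mpoly k[t]}, (forall i, linear_products s' (g i)) &
      f = \sum_i shift_var (c j) i * g i]
  else [set f | exists a, f = a%:MP].

Lemma linear_products_subspace s : subspace (linear_products s).
Proof.
elim: s => [|j s IH] /=; split.
- by exists 0.
- by move=> a _ _ [x ->] [y ->]; exists (a * x + y); rewrite mpolyCD mpolyCM mul_mpolyC.
- exists (fun=> 0) => [_|]; first exact: subspace0.
  by rewrite big1 // => i _; rewrite mulr0.
move=> a _ _ [f fs ->] [g gs ->]; exists (fun i => a *: f i + g i).
  by move=> i; apply: IH.2.
rewrite scaler_sumr -big_split; apply: eq_bigr => i _.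
by rewrite mulrDr -scalerAr.
Qed.

Lemma deg1_vanish (v : 'I_t -> k) f : deg_le 1 f -> f.@[v] = 0 ->
  exists a : 'I_t -> k, f = \sum_i a i *: shift_var v i.
Proof.
move=> df f0; have [a da ->] := taylor1 v df; exists (fun i => (a i)@_0).
rewrite f0 mpolyC0 add0r; apply: eq_bigr => i _.
by rewrite {1}(msize1_polyC (da i)) mulrC mul_mpolyC.
Qed.

Lemma linear_products_cons j s f g : deg_le 1 f -> f.@[c j] = 0 ->
  linear_products s g -> linear_products (j :: s) (f * g).
Proof.
move=> df f0 gs; have [a ->] := deg1_vanish df f0; exists (fun i => a i *: g).
  by move=> i; apply: subspaceZ gs; apply: linear_products_subspace.
by rewrite mulr_suml; apply: eq_bigr => i _; rewrite -scalerAr -scalerAl.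
Qed.

Lemma linear_products_prod s (F : T -> {mpoly k[t]}) :
  (forall j, j \in s -> deg_le 1 (F j) /\ (F j).@[c j] = 0) ->
  linear_products s (\prod_(j <- s) F j).
Proof.
elim: s => [_|j s IH Fs]; first by exists 1; rewrite big_nil.
rewrite big_cons; have [dj j0] := Fs j (mem_head j s).
by apply: linear_products_cons => //; apply: IH => i si; apply: Fs; rewrite in_cons si orbT.
Qed.

Lemma deg_le_prod s (F : T -> {mpoly k[t]}) :
  (forall j, j \in s -> deg_le 1 (F j)) -> deg_le (size s) (\prod_(j <- s) F j).
Proof.
elim: s => [_|j s IH Fs]; first by rewrite big_nil -mpolyC1; apply: deg_leC.
rewrite big_cons /= -add1n; apply: deg_leM; first exact: Fs (mem_head j s).
by apply: IH => i si; apply: Fs; rewrite in_cons si orbT.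
Qed.

(** The product of the homogeneous ideals of distinct points is, in degrees at least
    the number of points, the ideal of all polynomials vanishing at the points.
    Writing [f] as a combination of the linear polynomials vanishing at the first
    point and interpolating the coefficients at the others, one is left with
    terms [L * e], where [e] is a product of linear polynomials that is [1] at
    [c j] and [0] at the other points, and [L] is a linear polynomial vanishing
    at the first point.  As [f] vanishes at [c j], so does [L]; exchanging [L]
    with a factor of [e] exhibits the term as a product of the wanted kind. *)
Lemma vanish_linear_products s f :
  (forall i j, i \in s -> j \in s -> i != j -> exists e, c i e != c j e) ->
  uniq s -> deg_le (size s) f -> vanish_on s f -> linear_products s f.
Proof.
elim: s f => [|j0 s IH] f cs; first by move=> _ df _; exists f@_0; apply: msize1_polyC.
rewrite cons_uniq => /andP[j0s us] df f0.
have [lin linP] : {lin : T * T -> {mpoly k[t]} & forall p,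
    p.1 \in j0 :: s -> p.2 \in j0 :: s -> p.1 != p.2 ->
    [/\ deg_le 1 (lin p), (lin p).@[c p.1] = 0 & (lin p).@[c p.2] = 1]}.
  pose Q (p : T * T) g := p.1 \in j0 :: s -> p.2 \in j0 :: s -> p.1 != p.2 ->
    [/\ deg_le 1 g, g.@[c p.1] = 0 & g.@[c p.2] = 1].
  apply: (choice (P := Q)) => -[i j].
  have [ijs|nijs] := boolP [&& i \in j0 :: s, j \in j0 :: s & i != j]; last first.
    by exists 0 => is_ js ij; case/and3P: nijs.
  have /and3P[is_ js ij] := ijs; have [e cij] := cs i j is_ js ij.
  exists ((c j e - c i e)^-1 *: shift_var (c i) e) => _ _ _; split.
  - by apply: subspaceZ; [exact: deg_le_subspace|exact: deg_le_shift_var].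
  - by rewrite mevalZ meval_shift_var subrr mulr0.
  - by rewrite mevalZ meval_shift_var mulVf // subr_eq0 eq_sym.
have sub i : i \in s -> i \in j0 :: s by move=> si; rewrite in_cons si orbT.
have neq0 j : j \in s -> j0 != j by move=> js; apply: contraNneq j0s => ->.
pose F j g i := if i == j then g else lin (i, j).
pose E j g := \prod_(i <- s) F j g i.
pose e j := E j (lin (j0, j)).
have EE j g : j \in s -> E j g = g * \prod_(i <- s | i != j) lin (i, j).
  move=> js; rewrite /E (bigD1_seq j) //= {1}/F eqxx; congr (_ * _).
  by apply: eq_bigr => i /negPf ij; rewrite /F ij.
have e1 j : j \in s -> (e j).@[c j] = 1.
  move=> js; rewrite /e EE // mevalM rmorph_prod big_seq_cond big1 => [|i].
    by rewrite mulr1; case: (linP (j0, j)) => //=; rewrite ?mem_head ?sub ?neq0.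
  by case/andP=> si ij; case: (linP (i, j)) => //=; rewrite ?sub.
have e0 i j : j \in s -> i \in s -> i != j -> (e j).@[c i] = 0.
  move=> js si ij; rewrite /e /E (bigD1_seq i) //= /F (negPf ij) mevalM.
  by case: (linP (i, j)) => //=; rewrite ?sub // => _ -> _; rewrite mul0r.
have de j : j \in s -> deg_le (size s) (e j).
  move=> js; apply: deg_le_prod => i si; rewrite /F.
  have [ij|ij] := eqVneq i j; first by case: (linP (j0, j)) => //=; rewrite ?mem_head ?sub ?neq0.
  by case: (linP (i, j)) => //=; rewrite ?sub.
have subS := linear_products_subspace.
have [a da fE] := taylor1 (c j0) df.
rewrite f0 ?mem_head // mpolyC0 add0r in fE.
pose L j := \sum_i (a i).@[c j] *: shift_var (c j0) i.
have L0 j : j \in s -> (L j).@[c j] = 0.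
  move=> js; rewrite -[RHS](f0 j (sub _ js)) fE !raddf_sum; apply: eq_bigr => i _ /=.
  by rewrite mevalZ mevalM mulrC.
have dL j : deg_le 1 (L j).
  apply: subspace_sum => [|i _]; first exact: deg_le_subspace.
  by apply: subspaceZ; [exact: deg_le_subspace|exact: deg_le_shift_var].
have -> : f = \sum_i shift_var (c j0) i * (a i - \sum_(j <- s) (a i).@[c j] *: e j)
              + \sum_(j <- s) L j * e j.
  under [X in X + _]eq_bigr do rewrite mulrBr mulr_sumr.
  rewrite sumrB -fE -[LHS](subrK (\sum_(j <- s) L j * e j)); congr (_ - _ + _).
  rewrite [RHS]exchange_big; apply: eq_bigr => j _.
  by rewrite mulr_suml; apply: eq_bigr => i _; rewrite -scalerAl -scalerAr.
apply: subspaceD => //.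
  exists (fun i => a i - \sum_(j <- s) (a i).@[c j] *: e j) => // i.
  apply: IH => //; first by move=> x y xs ys; apply: cs; rewrite sub.
    apply: subspaceB; [exact: deg_le_subspace|exact: da|].
    rewrite big_seq; apply: subspace_sum => [|j js]; first exact: deg_le_subspace.
    by apply: subspaceZ; [exact: deg_le_subspace|exact: de].
  move=> j js; rewrite mevalB (raddf_sum (meval (c j))) (bigD1_seq j) //= mevalZ e1 // mulr1.
  rewrite big_seq_cond big1 ?addr0 ?subrr // => j1 /andP[sj1 j1j].
  by rewrite mevalZ e0 ?mulr0 // eq_sym.
rewrite big_seq; apply: subspace_sum => // j js.
have -> : L j * e j = lin (j0, j) * E j (L j) by rewrite /e !EE // mulrCA.
have [|||dl l0 _] := linP (j0, j); rewrite ?mem_head ?sub ?neq0 //.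
apply: linear_products_cons => //; apply: linear_products_prod => i si; rewrite /F.
have [ij|ij] := eqVneq i j; first by rewrite ij; split; [exact: dL|exact: L0].
by case: (linP (i, j)) => //=; rewrite ?sub.
Qed.
End Points.

Arguments vanish_on_subspace {k t T} c s.
Arguments linear_products_subspace {k t T} c s.

(** * Chains of subspaces stable under moving linear systems *)

(** Subtracting a multiple of the element of [U] with the same leading monomial
    lowers the leading monomial, and the monomial order is well founded. *)
Lemma sub_of_mlead (k : fieldType) t (U W : set {mpoly k[t]}) :
  subspace U -> subspace W -> U `<=` W ->
  (forall f, W f -> f != 0 -> exists g, [/\ U g, g != 0 & mlead g = mlead f]) ->
  W `<=` U.
Proof.
move=> sU sW UW lead f; elim/mleadrect: f => f IH Wf.
have [->|f0] := eqVneq f 0; first exact: subspace0.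
have [g [Ug g0 gf]] := lead f Wf f0.
set a := f@_(mlead f) / g@_(mlead g).
rewrite -[f](subrK (a *: g)); apply: subspaceD => //; last exact: subspaceZ.
have Wfg : W (f - a *: g) by apply: subspaceB => //; apply: subspaceZ => //; apply: UW.
have [->|fg0] := eqVneq (f - a *: g) 0; first exact: subspace0.
apply: IH => //; rewrite lt_neqAle; apply/andP; split.
  apply: contraNneq fg0 => e; rewrite -mleadc_eq0 e mcoeffB mcoeffZ -gf /a.
  by rewrite -gf divfK ?subrr // mleadc_eq0.
have le := mleadB_le f (a *: g).
apply: le_trans le _; rewrite leUx /=.
by rewrite lexx -gf mleadZ_le.
Qed.

Lemma bounded_degree_acc (k : fieldType) t (U : nat -> set {mpoly k[t]}) n :
  (forall i, subspace (U i)) -> (forall i, U i `<=` U i.+1) ->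
  (forall i, U i `<=` deg_le n) -> exists N, forall i, U i `<=` U N.
Proof.
move=> sU UU dU.
apply: (findim_acc (s := [seq bmnm m | m : 'X_{1..t < n.+1}])
  (phi := fun m (f : {mpoly k[t]}) => f@_m)) => //.
  by move=> m a f g; rewrite mcoeffD mcoeffZ.
move=> i j f Uf f0; suff -> : f = 0 by apply: subspace0.
apply/mpolyP => m; rewrite mcoeff0; have [mn|nm] := ltnP (mdeg m) n.+1.
  by apply: f0; apply/mapP; exists (BMultinom mn); rewrite ?mem_enum.
apply: memN_msupp_eq0; apply: msize_mdeg_ge.
by apply: leq_trans nm; apply: dU Uf.
Qed.

(** A form of the Hilbert basis theorem for families closed under multiplication
    only in large degrees and by polynomials of large degree.  If the chain kept
    growing, one could choose elements with new leading monomials in degrees that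
    increase by at least [l0] each time.  Dickson's lemma, applied to the exponents
    of these monomials and to the difference between the degree and the degree of
    the monomial, makes one of them a multiple of an earlier one by a polynomial
    of admissible degree, so it was not new. *)
Lemma almost_ideal_acc (k : fieldType) t (B : nat -> nat -> set {mpoly k[t]}) m0 l0 :
  (forall i n, subspace (B i n)) -> (forall i n, B i n `<=` B i.+1 n) ->
  (forall i n, B i n `<=` deg_le n) ->
  (forall i m l g f, (m0 <= m)%N -> (l0 <= l)%N -> deg_le l g -> B i m f ->
    B i (m + l)%N (g * f)) ->
  exists N n0, forall i n, (n0 <= n)%N -> B i n `<=` B N n.
Proof.
move=> sB BB dB mulB; apply: contrapT => nstab.
have BBn n := chain_subset (fun i => BB i n).
pose lead i n m := exists f, [/\ B i n f, f != 0 & mlead f = m].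
have [nx nxP] : {nx : nat * nat -> nat * nat * 'X_{1..t} & forall p,
    [/\ (p.1 <= (nx p).1.1)%N, (p.2 <= (nx p).1.2)%N,
        lead (nx p).1.1 (nx p).1.2 (nx p).2 & ~ lead p.1 (nx p).1.2 (nx p).2]}.
  pose Q (p : nat * nat) (q : nat * nat * 'X_{1..t}) := [/\ (p.1 <= q.1.1)%N,
    (p.2 <= q.1.2)%N, lead q.1.1 q.1.2 q.2 & ~ lead p.1 q.1.2 q.2].
  apply: (choice (P := Q)) => -[N n0]; apply: contrapT => none.
  apply: nstab; exists N, n0 => i n n0n.
  apply: subset_trans (BBn n _ _ (leq_maxl i N)) _.
  apply: sub_of_mlead => //; first exact: BBn (leq_maxr _ _).
  move=> f Bf f0; apply: contrapT => nlead; apply: none.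
  exists (maxn i N, n, mlead f); split=> //=; first exact: leq_maxr.
  by exists f.
pose st a := iter a (fun p => ((nx p).1.1, (nx p).1.2 + l0)%N) (0%N, m0).
pose ii a := (nx (st a)).1.1; pose nn a := (nx (st a)).1.2; pose mm a := (nx (st a)).2.
have st1 a b : (a < b)%N -> (ii a <= (st b).1)%N.
  move=> ab; have st1S : {homo (fun a => (st a).1) : a b / (a <= b)%N}.
    apply: homo_leq => [//||e]; first exact: leq_trans.
    by case: (nxP (st e)).
  exact: st1S ab.
have st2 : {homo (fun a => (st a).2) : a b / (a <= b)%N}.
  apply: homo_leq => [//||e]; first exact: leq_trans.
  by case: (nxP (st e)) => _ le _ _; apply: leq_trans le (leq_addr _ _).
have degm a : (mdeg (mm a) <= nn a)%N.
  case: (nxP (st a)) => _ _ [f [Bf f0 fm]] _.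
  by rewrite /mm -fm -ltnS mlead_deg //; apply: dB Bf.
have [a [b [ab le_ab]]] := dickson (enum {: option 'I_t})
  (fun o a => if o is Some i then mm a i else (nn a - mdeg (mm a))%N).
have m_ab : (mm a <= mm b)%MM.
  by apply/mnm_lepP => i; apply: (le_ab (Some i)); rewrite mem_enum.
have n_ab : (nn a - mdeg (mm a) <= nn b - mdeg (mm b))%N.
  by apply: (le_ab None); rewrite mem_enum.
have l_ab : (nn a + l0 <= nn b)%N.
  by case: (nxP (st b)) => _ le _ _; apply: leq_trans le; apply: (st2 _ _ ab).
case: (nxP (st a)) (nxP (st b)) => _ ma [f [Bf f0 fm]] _ [_ _ _ []].
have X0 m : 'X_[m] != 0 :> {mpoly k[t]} by rewrite -msize_poly_eq0 msizeX.
exists ('X_[(mm b - mm a)%MM] * f); split.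
- apply: (BBn _ (ii a)); first exact: st1.
  rewrite -/(nn b) -[nn b](subnKC (leq_trans (leq_addr l0 _) l_ab)).
  apply: mulB Bf; first exact: leq_trans (st2 0%N a _) ma.
    by rewrite leq_subRL // (leq_trans _ l_ab) // leq_addr.
  rewrite deg_leX.
  have := congr1 mdeg (submK m_ab); rewrite mdegD => mE.
  have := degm a; have := degm b; lia.
- by rewrite mulf_neq0 // X0.
- by rewrite mleadM ?X0 // mleadXm fm -/(mm a) submK.
Qed.

Section MovingPoints.
Variables (k : fieldType) (t : nat) (c : nat -> 'I_t -> k).
Implicit Types (f g h : {mpoly k[t]}) (A : nat -> set {mpoly k[t]}).

(** Large finite sets of points impose independent conditions on polynomials of
    degree smaller by [d] than their number.  The slack [d] absorbs the degree of
    a polynomial in [quotient_stab], and a number of additional points in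
    [multiples_stab]. *)
Definition interpolating := forall d, exists l0, forall s (v : nat -> k),
  uniq s -> (l0 <= size s)%N ->
  exists2 h, deg_le (size s - d) h & forall j, j \in s -> h.@[c j] = v j.

Definition critically_dense :=
  forall f, f != 0 -> exists m0, forall j, (m0 <= j)%N -> f.@[c j] != 0.

(** What the leading coefficients of a one-sided ideal satisfy: passing from
    degree [m] to degree [m.+1] multiplies by linear polynomials vanishing at a
    point that moves with [m]. *)
Definition moving_module A :=
  [/\ forall m, subspace (A m), forall m, A m `<=` deg_le m `&` vanish_on c (iota 0 m)
    & forall m i f, A m f -> A m.+1 (shift_var (c m) i * f)].

Hypothesis interp : interpolating.
Hypothesis dense : critically_dense.

Lemma interpolating_separated i j : i != j -> exists e, c i e != c j e.
Proof.
move=> ij; apply: contrapT => nsep.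
have cij : c i =1 c j by move=> e; apply/eqP; apply: contrapT => /negP ce; apply: nsep; exists e.
have [l0 H] := interp 0; pose s := undup (i :: j :: iota 0 l0).
have [] := H s (fun n => (n == i)%:R) (undup_uniq _).
  rewrite -{1}(size_iota 0 l0); apply: uniq_leq_size; first exact: iota_uniq.
  by move=> n ns; rewrite mem_undup !in_cons ns !orbT.
move=> h _ hs; have := hs i; have := hs j.
rewrite !mem_undup !in_cons !eqxx ?orbT /= => /(_ isT) hj /(_ isT) hi.
move: hj; rewrite -(meval_eq _ cij) hi eq_sym (negPf ij) => /eqP.
by rewrite oner_eq0.
Qed.

Lemma moving_module_products A m l f g : moving_module A ->
  linear_products c (iota m l) g -> A m f -> A (m + l)%N (g * f).
Proof.
case=> sA _ mulA; elim: l m g f => [|l IH] m g f /=.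
  by move=> [a ->] Af; rewrite addn0 mul_mpolyC; apply: subspaceZ.
move=> [h hP ->] Af; rewrite mulr_suml addnS -addSn.
apply: subspace_sum => // i _; rewrite mulrAC mulrC; apply: IH => //.
exact: mulA.
Qed.

Lemma moving_module_vanish A m l f g : moving_module A -> deg_le l g ->
  vanish_on c (iota m l) g -> A m f -> A (m + l)%N (g * f).
Proof.
move=> modA dg g0; apply: moving_module_products => //.
apply: vanish_linear_products; rewrite ?size_iota ?iota_uniq //.
by move=> i j _ _; apply: interpolating_separated.
Qed.

Section Chain.
Variables (A : nat -> nat -> set {mpoly k[t]}) (f : {mpoly k[t]}) (d : nat).
Hypothesis modA : forall i, moving_module (A i).
Hypothesis chainA : forall i m, A i m `<=` A i.+1 m.
Hypotheses (A0f : A 0 d f) (f0 : f != 0).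

Let subA i m : subspace (A i m). Proof. by case: (modA i). Qed.
Let df : deg_le d f. Proof. by case: (modA 0) => _ /(_ _ _ A0f)[]. Qed.
Let chainAle m := chain_subset (fun i => @chainA i m).

(** By interpolation, a polynomial [s] of degree [l] differs by a multiple of [f]
    from one that vanishes at [l] given points where [f] does not vanish.  So
    [A], taken modulo multiples of [f], is in large degrees stable under
    multiplication by all polynomials of large degree. *)
Lemma quotient_stab : exists N n0, forall i n g, (n0 <= n)%N -> A i n g ->
  exists2 h, deg_le (n - d) h & A N n (g + f * h).
Proof.
pose B i n : set {mpoly k[t]} := [set g | deg_le n g /\
  exists2 h, deg_le (n - d) h & A i n (g + f * h)].
have [m1 fm1] := dense f0; have [l0 H] := interp d.
suff [N [n0 NP]] : exists N n0, forall i n, (n0 <= n)%N -> B i n `<=` B N n.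
  exists N, n0 => i n g nn Ag; case: (NP i n nn g) => //; split.
    by case: (modA i) => _ /(_ _ _ Ag)[].
  by exists 0; [exact: subspace0 (deg_le_subspace _)|rewrite mulr0 addr0].
apply: (@almost_ideal_acc _ _ B (maxn m1 d) (maxn l0 d)).
- move=> i n; split.
    split; first exact: subspace0 (deg_le_subspace _).
    exists 0; first exact: subspace0 (deg_le_subspace _).
    by rewrite mulr0 addr0; apply: subspace0.
  move=> a g g' [dg [h dh Ah]] [dg' [h' dh' Ah']]; split.
    exact: (deg_le_subspace _).2.
  exists (a *: h + h'); first exact: (deg_le_subspace _).2.
  rewrite mulrDr -scalerAr addrACA -scalerDr.
  by case: (subA i n) => _; apply.
- by move=> i n g [dg [h dh Ah]]; split=> //; exists h => //; apply: chainA.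
- by move=> i n g [].
move=> i m l s g; rewrite !geq_max => /andP[m1m dm] /andP[l0l dl] ds [dg [h dh Ah]].
split; first by rewrite addnC; apply: deg_leM.
have [|h' dh' h'E] := H (iota m l) (fun j => s.@[c j] / f.@[c j]) (iota_uniq _ _).
  by rewrite size_iota.
rewrite size_iota in dh'.
have dw : deg_le l (s - f * h').
  apply: subspaceB => //; first exact: deg_le_subspace.
  by rewrite -[X in deg_le X](subnKC dl); apply: deg_leM.
exists ((s - f * h') * h - h' * g).
  apply: subspaceB; first exact: deg_le_subspace.
    by rewrite addnC -addnBA //; apply: deg_leM.
  by rewrite addnC -addnBAC // addnC addnC; apply: deg_leM.
have -> : s * g + f * ((s - f * h') * h - h' * g) = (s - f * h') * (g + f * h) by ring.
apply: moving_module_vanish => // j jml; rewrite mevalB mevalM h'E // mulrC divfK ?subrr //.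
by move: jml; rewrite mem_iota => /andP[mj _]; apply: fm1; apply: leq_trans mj.
Qed.

(** A multiple [f h] of [f] in [A i n] is determined, up to the multiples already
    known to lie in [A i n], by the values of [h] at the finitely many points
    where [f] vanishes. *)
Lemma multiples_stab : exists N n0, forall i n h, (n0 <= n)%N -> deg_le (n - d) h ->
  A i n (f * h) -> A N n (f * h).
Proof.
have [m1 fm1] := dense f0; pose m0 := maxn m1 d.
have [l0 H] := interp m0; pose l1 := maxn l0 1.
pose G i n : set {mpoly k[t]} := [set h | deg_le (n - d) h /\ A i n (f * h)].
have sG i n : subspace (G i n).
  split; first by split; [exact: subspace0 (deg_le_subspace _)|rewrite mulr0; exact: subspace0].
  move=> a h h' [dh Ah] [dh' Ah']; split; first exact: (deg_le_subspace _).2.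
  by rewrite mulrDr -scalerAr; case: (subA i n) => _; apply.
have GG n : forall i j, (i <= j)%N -> G i n `<=` G j n.
  by move=> i j ij h [dh Ah]; split=> //; apply: chainAle Ah.
have push i n n' h : (m0 <= n)%N -> (n + l1 <= n')%N -> G i n h ->
    exists2 h', G i n' h' & forall j, (j < m0)%N -> h'.@[c j] = h.@[c j].
  move=> m0n nn' [dh Ah]; have dn : (d <= n)%N by apply: leq_trans m0n; apply: leq_maxr.
  pose l := (n' - n)%N; have n'E : n' = (n + l)%N by rewrite /l subnKC //; lia.
  (* a polynomial that is 1 at the first m0 points and admissible as a multiplier
     from degree n to degree n + l *)
  pose s := iota 0 m0 ++ iota n l.
  have szs : size s = (m0 + l)%N by rewrite size_cat !size_iota.
  have us : uniq s.
    rewrite cat_uniq !iota_uniq andbT /=; apply/hasPn => j; rewrite !mem_iota.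
    by move=> /andP[nj _]; rewrite /= -leqNgt add0n (leq_trans m0n).
  have [|w dw wE] := H s (fun j => (j < m0)%N%:R) us.
    by rewrite szs; rewrite /l1 in nn'; lia.
  rewrite szs addKn in dw.
  exists (w * h) => [|j jm0]; last by rewrite mevalM wE ?jm0 ?mul1r // mem_cat mem_iota jm0.
  split; first by rewrite n'E -addnBAC // addnC; apply: deg_leM.
  rewrite mulrCA n'E; apply: moving_module_vanish => // j jnl.
  by rewrite wE ?mem_cat ?jnl ?orbT // ltnNge (leq_trans m0n) //; move: jnl; rewrite mem_iota; lia.
(* the degrees m0 + i * l1 are far enough apart for push to make F increasing;
   n0 below leaves room for one more push *)
pose F i : set {mpoly k[t]} := [set h | exists2 h', G i (m0 + i * l1)%N h' &
  forall j, (j < m0)%N -> h'.@[c j] = h.@[c j]].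
have [||||N FN] := @findim_acc k _ _ (iota 0 m0) (fun j (h : {mpoly k[t]}) => h.@[c j]) F.
- by move=> j a h h'; rewrite mevalD mevalZ.
- move=> i; split; first by exists 0 => //; apply: subspace0.
  move=> a h h' [g Gg gh] [g' Gg' gh']; exists (a *: g + g').
    by case: (sG i (m0 + i * l1)%N) => _; apply.
  by move=> j jm0; rewrite !mevalD !mevalZ gh // gh'.
- move=> i h [g Gg gh]; have [||g' Gg' g'E] := push i _ (m0 + i.+1 * l1)%N g _ _ Gg.
  + exact: leq_addr.
  + by rewrite mulSn; lia.
  exists g' => [|j jm0]; first exact: GG Gg'.
  by rewrite g'E ?gh.
- move=> i j h _ h0; exists 0 => [|e em0]; first exact: subspace0.
  by rewrite meval0 h0 // mem_iota.
have l1_gt0 : (0 < l1)%N by rewrite /l1; lia.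
exists N, (m0 + N * l1 + l1)%N => i n h n0n dh Ah.
have [||g Gg gh] := push i n (m0 + (n + i).+1 * l1)%N h _ _ (conj dh Ah).
- by lia.
- by nia.
have Fh : F (n + i).+1 h.
  by exists g => //; apply: GG Gg; rewrite -addnS; lia.
have {g Gg gh Fh} [g Gg gh] := FN _ _ Fh.
have [||g' [dg' Ag'] g'E] := push N _ n g _ _ Gg; [exact: leq_addr|exact: n0n|].
have dn : (d <= n)%N by rewrite /m0 in n0n; lia.
have fh : A N n (f * (h - g')).
  rewrite mulrC -{1}(subnKC dn); apply: moving_module_vanish => //.
  - by apply: subspaceB => //; apply: deg_le_subspace.
  - move=> j; rewrite mem_iota subnKC // => /andP[dj jn]; rewrite mevalB.
    have [jm0|m0j] := ltnP j m0; first by rewrite g'E // gh // subrr.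
    have zero i' h' : A i' n (f * h') -> h'.@[c j] = 0.
      move=> Afh; case: (modA i') => _ /(_ _ _ Afh)[_ /(_ j)] + _.
      rewrite mem_iota jn mevalM => /(_ isT) /eqP; rewrite mulf_eq0 => /orP[|/eqP//].
      by rewrite (negPf (fm1 _ _)) //; apply: leq_trans m0j; apply: leq_maxl.
    by rewrite (zero _ _ Ah) (zero _ _ Ag') subrr.
  - exact: chainAle A0f.
by rewrite -[h](subrK g') mulrDr; apply: subspaceD.
Qed.

End Chain.

(** By the modular law, [quotient_stab] and [multiples_stab] control all large
    degrees; each of the remaining degrees is finite-dimensional. *)
Theorem moving_module_acc (A : nat -> nat -> set {mpoly k[t]}) :
  (forall i, moving_module (A i)) -> (forall i m, A i m `<=` A i.+1 m) ->
  exists N, forall i m, A i m `<=` A N m.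
Proof.
move=> modA chainA.
have sA i m : subspace (A i m) by case: (modA i).
have chainAle m := chain_subset (fun i => @chainA i m).
have [[i0 [d [f [Af f0]]]]|none] := pselect (exists i d f, A i d f /\ f != 0); last first.
  exists 0%N => i m f Af; have [->|f0] := eqVneq f 0; first exact: subspace0.
  by case: none; exists i, m, f.
pose A' i := A (i0 + i)%N.
have modA' i : moving_module (A' i) by apply: modA.
have chainA' i m : A' i m `<=` A' i.+1 m by rewrite /A' addnS; apply: chainA.
have chainA'le m := chain_subset (fun i => @chainA' i m).
have A'f : A' 0 d f by rewrite /A' addn0.
suff [N NP] : exists N, forall i m, A' i m `<=` A' N m.
  exists (i0 + N)%N => i m; apply: subset_trans (NP i m).
  exact: chainAle (leq_addl _ _).
have [N1 [n1 NP1]] := quotient_stab modA' chainA' A'f f0.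
have [N2 [n2 NP2]] := multiples_stab modA' chainA' A'f f0.
have low n : exists N, forall i m, (m < n)%N -> A' i m `<=` A' N m.
  elim: n => [|n [N NP]]; first by exists 0%N.
  have [|||M MP] := @bounded_degree_acc k t (fun i => A' i n) n.
  - by move=> i; apply: sA.
  - by move=> i; apply: chainA'.
  - by move=> i h Ah; case: (modA' i) => _ /(_ _ _ Ah)[].
  exists (maxn N M) => i m; rewrite ltnS leq_eqVlt => /predU1P[->|mn].
    by apply: subset_trans (MP i) _; apply: chainA'le (leq_maxr _ _).
  by apply: subset_trans (NP i m mn) _; apply: chainA'le (leq_maxl _ _).
have [N3 NP3] := low (maxn n1 n2).
exists (maxn (maxn N1 N2) N3) => i m; set N := maxn _ _.
have N1N : (N1 <= N)%N by rewrite /N; lia.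
have N2N : (N2 <= N)%N by rewrite /N; lia.
have N3N : (N3 <= N)%N by rewrite /N; lia.
have [mn|nm] := ltnP m (maxn n1 n2).
  by apply: subset_trans (NP3 i m mn) _; apply: chainA'le.
move: nm; rewrite geq_max => /andP[n1m n2m] g Ag.
have [h dh Ah] := NP1 i m g n1m Ag.
have AhN : A' N m (g + f * h) by apply: chainA'le Ah.
rewrite -[g](addrK (f * h)); apply: subspaceB => //; first exact: sA.
apply: (chainA'le m _ _ N2N); apply: (NP2 (maxn i N)) => //.
rewrite -[f * h](addKr g) addrC; apply: subspaceB; first exact: sA.
  exact: chainA'le (leq_maxr _ _) _ AhN.
exact: chainA'le (leq_maxl _ _) _ Ag.
Qed.
End MovingPoints.

(** * Leading coefficients of ideals *)

Section LeadingCoefficients.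
Variables (k : fieldType) (t : nat) (c : nat -> 'I_t -> k) (V : lmodType k).
Variables (T : nat -> {mpoly k[t]} -> V) (D : 'I_t -> V -> V) (s : 'I_t -> nat -> k).
Implicit Types (I : set V) (f : {mpoly k[t]}) (u : V).

Hypotheses (linT : forall m, linear (T m)) (linD : forall i, linear (D i)).
Hypothesis s_neq0 : forall i m, s i m != 0.
Hypothesis DT : forall i m f, D i (T m f) = T m.+1 (s i m *: (shift_var (c m) i * f)).

(** The coefficients that occur in degree [m] of the generated algebra. *)
Definition admissible m : set {mpoly k[t]} := deg_le m `&` vanish_on c (iota 0 m).

Definition expansion n : set V := [set u | exists2 F : nat -> {mpoly k[t]},
  (forall j, admissible j (F j)) & u = \sum_(j < n) T j (F j)].

Definition expandable : set V := [set u | exists n, expansion n u].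

Definition lead_coefs I m : set {mpoly k[t]} :=
  [set f | admissible m f /\ exists2 u, I u & expansion m (u - T m f)].

Lemma admissible_subspace m : subspace (admissible m).
Proof.
split; first by split; apply: subspace0; [exact: deg_le_subspace|exact: vanish_on_subspace].
move=> a f g [df f0] [dg g0]; split; first exact: (deg_le_subspace m).2.
exact: (vanish_on_subspace c (iota 0 m)).2.
Qed.

Lemma admissible_shift m i f : admissible m f -> admissible m.+1 (shift_var (c m) i * f).
Proof.
move=> [df f0]; split; first by rewrite -add1n; apply: deg_leM => //; apply: deg_le_shift_var.
move=> j; rewrite mem_iota leq0n add0n ltnS leq_eqVlt mevalM => /predU1P[->|jm].
  by rewrite meval_shift_var subrr mul0r.
by rewrite f0 ?mulr0 // mem_iota.
Qed.

Lemma T0 m : T m 0 = 0.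
Proof. by have := linT m (-1) 0 0; rewrite scaler0 addr0 scaleN1r addNr. Qed.

Lemma D0 i : D i 0 = 0.
Proof. by have := linD i (-1) 0 0; rewrite scaler0 addr0 scaleN1r addNr. Qed.

Lemma DD i : {morph D i : u v / u + v}.
Proof. by move=> u v; have := linD i 1 u v; rewrite !scale1r. Qed.

Lemma expansion_subspace n : subspace (expansion n).
Proof.
split.
  exists (fun=> 0) => [j|]; first by apply: subspace0; apply: admissible_subspace.
  by rewrite big1 // => j _; rewrite T0.
move=> a _ _ [F admF ->] [G admG ->]; exists (fun j => a *: F j + G j).
  by move=> j; apply: (admissible_subspace j).2.
by rewrite scaler_sumr -big_split; apply: eq_bigr => j _; rewrite linT.
Qed.

Lemma expansionS n : expansion n `<=` expansion n.+1.
Proof.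
move=> _ [F admF ->]; exists (fun j => if (j < n)%N then F j else 0) => [j|].
  by case: ifP => // _; apply: subspace0; apply: admissible_subspace.
by rewrite big_ord_recr /= ltnn T0 addr0; apply: eq_bigr => j _; rewrite ltn_ord.
Qed.

Lemma expansion_D i n u : expansion n u -> expansion n.+1 (D i u).
Proof.
move=> [F admF ->].
exists (fun j => if j is j'.+1 then s i j' *: (shift_var (c j') i * F j') else 0).
  case=> [|j]; first by apply: subspace0; apply: admissible_subspace.
  by apply: subspaceZ; [exact: admissible_subspace|exact: admissible_shift].
rewrite big_ord_recl T0 add0r (big_morph (D i) (DD i) (D0 i)).
by apply: eq_bigr => j _; rewrite DT.
Qed.

Lemma expandable_subspace : subspace expandable.
Proof.
have leE := chain_subset (fun n => @expansionS n).
split; first by exists 0%N; apply: subspace0; apply: expansion_subspace.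
move=> a u v [n nu] [m mv]; exists (maxn n m); apply: (expansion_subspace _).2.
  exact: leE (leq_maxl _ _) _ nu.
exact: leE (leq_maxr _ _) _ mv.
Qed.

Lemma expandable_D i u : expandable u -> expandable (D i u).
Proof. by move=> [n nu]; exists n.+1; apply: expansion_D. Qed.

Lemma expandable_T m f : admissible m f -> expandable (T m f).
Proof.
move=> admf; exists m.+1; exists (fun j => if j == m then f else 0).
  by move=> j; case: eqP => [->//|_]; apply: subspace0; apply: admissible_subspace.
rewrite big_ord_recr /= eqxx big1 ?add0r // => j _.
by rewrite ltn_eqF ?T0.
Qed.

Lemma lead_coefs_module I : subspace I -> (forall i u, I u -> I (D i u)) ->
  moving_module c (lead_coefs I).
Proof.
move=> sI DI.
have sL m : subspace (lead_coefs I m).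
  split.
    split; first exact: subspace0 (admissible_subspace m).
    exists 0; first exact: subspace0.
    by rewrite T0 subr0; apply: subspace0; apply: expansion_subspace.
  move=> a f g [admf [u Iu uf]] [admg [v Iv vg]]; split.
    exact: (admissible_subspace m).2.
  exists (a *: u + v); first exact: sI.2.
  by rewrite linT opprD addrACA -scalerBr; apply: (expansion_subspace m).2.
split=> // [m f []//|m i f [admf [u Iu uf]]].
rewrite -[_ * f](scalerK (s_neq0 i m)); apply: subspaceZ => //; split.
  by apply: subspaceZ; [exact: admissible_subspace|exact: admissible_shift].
exists (D i u); first exact: DI.
rewrite -DT; have -> : D i u - D i (T m f) = D i (u - T m f).
  by apply/eqP; rewrite subr_eq -DD subrK.
exact: expansion_D.
Qed.

(** Induction on the length of the expansion: the leading term of an element of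
    [J] can be removed by subtracting an element of [I]. *)
Lemma sub_of_lead_coefs I J : subspace I -> subspace J -> I `<=` J ->
  J `<=` expandable -> (forall m, lead_coefs J m `<=` lead_coefs I m) -> J `<=` I.
Proof.
move=> sI sJ IJ eJ lead u Ju; have [n nu] := eJ u Ju.
elim: n u Ju nu => [|n IH] u Ju [F admF uE].
  by rewrite uE big_ord0; apply: subspace0.
have Fu : expansion n (u - T n (F n)).
  by exists F => //; rewrite uE big_ord_recr addrK.
have [|_ [v Iv vF]] := lead n (F n); first by split; [exact: admF|exists u].
rewrite -[u](subrK v); apply: subspaceD => //; apply: IH.
  by apply: subspaceB => //; apply: IJ.
have -> : u - v = (u - T n (F n)) - (v - T n (F n)).
  by rewrite opprB addrA subrK.
by apply: subspaceB; first exact: expansion_subspace.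
Qed.

Lemma expandable_acc (I : nat -> set V) : interpolating c -> critically_dense c ->
  (forall n, subspace (I n)) -> (forall n i u, I n u -> I n (D i u)) ->
  (forall n, I n `<=` expandable) -> (forall n, I n `<=` I n.+1) ->
  exists N, forall n, I n `<=` I N.
Proof.
move=> interp dense sI DI eI II.
have [|i m f [admf [u Iu uf]]|N NP] :=
    @moving_module_acc k t c interp dense (fun n => lead_coefs (I n)).
- by move=> n; apply: lead_coefs_module => // i u; apply: DI.
- by split=> //; exists u => //; apply: II.
exists N => n u Iu.
apply: (@sub_of_lead_coefs (I N) (I (maxn n N))) => //.
- by apply: chain_subset => //; apply: leq_maxr.
- exact: chain_subset II _ _ (leq_maxl n N) _ Iu.
Qed.

End LeadingCoefficients.

Section GeneratedAlgebra.
Variables (k : fieldType) (t : nat) (c : nat -> 'I_t -> k) (A : algType k).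
Variables (T : nat -> {mpoly k[t]} -> A) (g : 'I_t -> A) (s : 'I_t -> nat -> k).
Hypotheses (interp : interpolating c) (dense : critically_dense c).
Hypotheses (linT : forall m, linear (T m)) (s_neq0 : forall i m, s i m != 0).
Hypothesis T01 : T 0 1 = 1.

Local Notation R := (subalg (range g)).

Let gen i : R := Subalg (let cG := range g in
  introT (gen_subalgP cG (g i)) (fun S _ GS => GS _ (ex_intro2 _ _ i Logic.I erefl))).

Let image_subspace (I : set R) : I 0 -> (forall x y, I x -> I y -> I (x + y)) ->
  (forall a x, I x -> I (a *: x)) -> subspace (\val @` I : set A).
Proof.
move=> I0 ID IZ; split; first by exists 0; rewrite ?raddf0.
move=> a _ _ [x Ix <-] [y Iy <-]; exists (a *: x + y); first by apply: ID => //; apply: IZ.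
by rewrite linearP.
Qed.

Let image_acc (I : nat -> set R) : (forall n, I n `<=` I n.+1) ->
  (exists N, forall n, (\val @` I n : set A) `<=` \val @` I N) ->
  exists N, forall n, (N <= n)%N -> I n = I N.
Proof.
move=> II [N NP]; exists N => n Nn; apply/seteqP; split; last exact: chain_subset Nn.
by move=> x Ix; have [|y Iy /val_inj <-] := NP n (\val x); first by exists x.
Qed.

Let expandable1 : expandable c T 1.
Proof.
rewrite -T01; apply: expandable_T => //; split=> //.
by rewrite -mpolyC1; apply: deg_leC.
Qed.

(** The elements that map expandable elements to expandable elements by left
    multiplication form a subalgebra containing the generators, so the whole
    algebra is expandable, and [expandable_acc] applies. *)
Lemma left_noetherian_of_leading :
  (forall i m f, g i * T m f = T m.+1 (s i m *: (shift_var (c m) i * f))) ->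
  left_noetherian R.
Proof.
move=> gT I idI II.
have linD i : linear (fun u => g i * u) by move=> a u v; rewrite mulrDr scalerAr.
have full x : x \in gen_subalg (range g) -> expandable c T x.
  have sE := expandable_subspace c linT.
  pose S : {pred A} := fun x => `[< forall u, expandable c T u -> expandable c T (x * u) >].
  have SP y : reflect (forall u, expandable c T u -> expandable c T (y * u)) (y \in S).
    exact: asboolP.
  move=> /gen_subalgP /(_ S) xS; rewrite -[x]mulr1.
  apply: (elimT (SP x) _ 1 expandable1); apply: xS.
  - split; first by apply/SP => u; rewrite mul1r.
      move=> a x1 x2 /SP E1 /SP E2; apply/SP => u Eu.
      by rewrite mulrDl -scalerAl; apply: sE.2; [apply: E1|apply: E2].
    move=> x1 x2 /SP E1 /SP E2; apply/SP => u Eu.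
    by rewrite -mulrA; apply: E1; apply: E2.
  - move=> _ [i _ <-]; apply/SP => u Eu.
    exact: (expandable_D linT linD gT).
apply: image_acc => //; apply: (expandable_acc linT linD s_neq0 gT) => // [n|n i|n|n].
- have [I0 ID IM] := idI n; apply: image_subspace => // a x Ix.
  by rewrite -[x]mul1r scalerAl; apply: IM.
- have [I0 ID IM] := idI n.
  by move=> _ [x Ix <-]; exists (gen i * x); first exact: IM.
- by move=> _ [x Ix <-]; apply: full; apply: valP.
- by move=> _ [x Ix <-]; exists x => //; apply: II.
Qed.

Lemma right_noetherian_of_leading :
  (forall i m f, T m f * g i = T m.+1 (s i m *: (shift_var (c m) i * f))) ->
  right_noetherian R.
Proof.
move=> gT I idI II.
have linD i : linear (fun u => u * g i) by move=> a u v; rewrite mulrDl scalerAl.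
have full x : x \in gen_subalg (range g) -> expandable c T x.
  have sE := expandable_subspace c linT.
  pose S : {pred A} := fun x => `[< forall u, expandable c T u -> expandable c T (u * x) >].
  have SP y : reflect (forall u, expandable c T u -> expandable c T (u * y)) (y \in S).
    exact: asboolP.
  move=> /gen_subalgP /(_ S) xS; rewrite -[x]mul1r.
  apply: (elimT (SP x) _ 1 expandable1); apply: xS.
  - split; first by apply/SP => u; rewrite mulr1.
      move=> a x1 x2 /SP E1 /SP E2; apply/SP => u Eu.
      by rewrite mulrDr -scalerAr; apply: sE.2; [apply: E1|apply: E2].
    move=> x1 x2 /SP E1 /SP E2; apply/SP => u Eu.
    by rewrite mulrA; apply: E2; apply: E1.
  - move=> _ [i _ <-]; apply/SP => u Eu.
    exact: (expandable_D linT linD gT).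
apply: image_acc => //; apply: (expandable_acc linT linD s_neq0 gT) => // [n|n i|n|n].
- have [I0 ID IM] := idI n; apply: image_subspace => // a x Ix.
  by rewrite -[x]mulr1 scalerAr; apply: IM.
- have [I0 ID IM] := idI n.
  by move=> _ [x Ix <-]; exists (x * gen i); first exact: IM.
- by move=> _ [x Ix <-]; apply: full; apply: valP.
- by move=> _ [x Ix <-]; exists x => //; apply: II.
Qed.

End GeneratedAlgebra.

(** * Eulerian derivatives as weighted shifts *)

Section WeightedShifts.
Variable k : fieldType.
Implicit Types (a b : int -> k) (f : laurent k).

Definition weighted_shift_fun a m f : laurent k :=
  \sum_(n <- monalg.msupp f) monalg.mcoeff n f *: (a n *: ymon k (n - m%:Z)).

HB.instance Definition _ a (m : nat) :=
  GRing.isLinear.Build k (laurent k) (laurent k) *:%R (weighted_shift_fun a m)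
    (monomial_map_linear a (fun n => n - m%:Z)).

(** y^n |-> a(n) y^(n - m); these operators multiply like elements of a skew
    polynomial ring whose coefficients are functions of n. *)
Definition weighted_shift a m : endo (laurent k) :=
  weighted_shift_fun a m : {linear laurent k -> laurent k}.

Lemma monomial_map_ymon (a : int -> k) (r : int -> int) n :
  \sum_(j <- monalg.msupp (ymon k n)) monalg.mcoeff j (ymon k n) *: (a j *: ymon k (r j))
  = a n *: ymon k (r n).
Proof.
rewrite monalg.msuppU oner_eq0 finmap.big_seq_fset1.
by rewrite /ymon monalg.mcoeffUU scale1r.
Qed.

Lemma weighted_shift_ymon a m n : weighted_shift a m (ymon k n) = a n *: ymon k (n - m%:Z).
Proof. exact: monomial_map_ymon. Qed.

Lemma endo_ymonP (u v : endo (laurent k)) :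
  (forall n, u (ymon k n) = v (ymon k n)) -> u = v.
Proof.
move=> uv; apply: endoP => f.
have fE : f = \sum_(n <- monalg.msupp f) monalg.mcoeff n f *: ymon k n.
  rewrite {1}[f]monalg.monalgE; apply: eq_bigr => n _; apply/monalg.malgP => j.
  by rewrite monalg.mcoeffZ !monalg.mcoeffU mulrnAr mulr1.
have expand (w : endo (laurent k)) :
    w f = \sum_(n <- monalg.msupp f) monalg.mcoeff n f *: w (ymon k n).
  rewrite {1}fE /endo_fun linear_sum; apply: eq_bigr => n _.
  by rewrite linearZ.
by rewrite !expand; apply: eq_bigr => n _; rewrite uv.
Qed.

Lemma weighted_shift_ext a b m : a =1 b -> weighted_shift a m = weighted_shift b m.
Proof. by move=> /funext ->. Qed.

Lemma weighted_shift_linear (x : k) a b m :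
  weighted_shift (fun n => x * a n + b n) m = x *: weighted_shift a m + weighted_shift b m.
Proof.
apply: endo_ymonP => n.
transitivity (x *: weighted_shift a m (ymon k n) + weighted_shift b m (ymon k n)); last by [].
by rewrite !weighted_shift_ymon scalerDl scalerA.
Qed.

Lemma weighted_shiftM a b m l :
  weighted_shift a m * weighted_shift b l =
  weighted_shift (fun n => a (n - l%:Z) * b n) (m + l)%N.
Proof.
apply: endo_ymonP => n.
transitivity (weighted_shift a m (weighted_shift b l (ymon k n))); first by [].
have scale (w : endo (laurent k)) x f : w (x *: f) = x *: w f by rewrite /endo_fun linearZ.
rewrite weighted_shift_ymon scale !weighted_shift_ymon scalerA.
by rewrite [b n * _]mulrC; congr (_ *: ymon k _); lia.
Qed.

Lemma weighted_shift1 : weighted_shift (fun=> 1) 0 = 1.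
Proof. by apply: endo_ymonP => n; rewrite weighted_shift_ymon scale1r subr0. Qed.

Lemma eulerian_weighted_shift (p : k) : p != 1 ->
  eulerian_endo p = weighted_shift (fun n => (p - 1)^-1 * (p ^ n - 1)) 1.
Proof.
move=> p1; apply: endo_ymonP => n; rewrite weighted_shift_ymon.
transitivity (eulerian p (ymon k n)); first by [].
rewrite /eulerian (negPf p1) /ysubst (monomial_map_ymon (fun n => p ^ n) id).
rewrite -{2}[ymon k n]scale1r -scalerBl -scalerAl -scalerAr scalerA -ymonD.
by congr (_ *: ymon k _); lia.
Qed.

End WeightedShifts.

Section EulerianAlgebra.
Variables (k : fieldType) (t : nat) (p : 'I_t -> k).
Hypotheses (p0 : forall i, p i != 0) (p1 : forall i, p i != 1).

Definition power_point (n : int) (i : 'I_t) : k := p i ^ n.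

Local Notation R := (subalg (range (fun i : 'I_t => eulerian_endo (p i)))).

Lemma eulerian_left_noetherian :
  interpolating (fun n => power_point n%:Z) ->
  critically_dense (fun n => power_point n%:Z) -> left_noetherian R.
Proof.
move=> interp dense.
pose T m (f : {mpoly k[t]}) := weighted_shift (fun n => f.@[power_point n]) m.
apply: (left_noetherian_of_leading interp dense (T := T)
  (s := fun i m => (p i - 1)^-1 * (p i ^ m%:Z)^-1)).
- by move=> m a f g; rewrite -weighted_shift_linear; apply: weighted_shift_ext => n;
    rewrite mevalD mevalZ.
- by move=> i m; rewrite mulf_neq0 // invr_eq0 ?subr_eq0 // expfz_neq0.
- by rewrite -weighted_shift1; apply: weighted_shift_ext => n; rewrite meval1.
move=> i m f; rewrite eulerian_weighted_shift // weighted_shiftM add1n.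
apply: weighted_shift_ext => n.
rewrite mevalZ mevalM meval_shift_var /power_point expfzDr // -invr_expz.
have := expfz_neq0 m%:Z (p0 i); have : p i - 1 != 0 by rewrite subr_eq0.
by move: (p i ^ n) (p i ^ m%:Z) => x y *; field; apply/andP.
Qed.

(** The operators are now normalised as y^n |-> f(p^(n - m)) y^(n - m), so that
    multiplying on the right by a generator acts on leading coefficients. *)
Lemma eulerian_right_noetherian :
  interpolating (fun n => power_point (Negz n)) ->
  critically_dense (fun n => power_point (Negz n)) -> right_noetherian R.
Proof.
move=> interp dense.
pose T m (f : {mpoly k[t]}) := weighted_shift (fun n => f.@[power_point (n - m%:Z)]) m.
apply: (right_noetherian_of_leading interp dense (T := T)
  (s := fun i m => (p i - 1)^-1 * p i ^+ m.+1)).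
- by move=> m a f g; rewrite -weighted_shift_linear; apply: weighted_shift_ext => n;
    rewrite mevalD mevalZ.
- by move=> i m; rewrite mulf_neq0 ?expf_neq0 // invr_eq0 ?subr_eq0.
- by rewrite -weighted_shift1; apply: weighted_shift_ext => n; rewrite meval1.
move=> i m f; rewrite eulerian_weighted_shift // weighted_shiftM addn1.
apply: weighted_shift_ext => n.
have -> : n - 1 - m%:Z = n - m.+1%:Z by lia.
rewrite mevalZ mevalM meval_shift_var /power_point.
rewrite [p i ^ (n - _)]expfzDr // NegzE -invr_expz -exprnP.
have := expf_neq0 m.+1 (p0 i); have : p i - 1 != 0 by rewrite subr_eq0.
by move: (p i ^ n) (p i ^+ m.+1) => x y *; field; apply/andP.
Qed.

End EulerianAlgebra.

(** * Points whose powers are in general position *)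

(** The monomials of degree at most [b] in each variable are numbered by writing
    the numbers below [b.+1 ^ t] in base [b.+1]. *)
Section Digits.
Variables (b t : nat).
Local Notation B := b.+1.

Definition digit (s i : nat) : nat := ((s %/ B ^ i) %% B)%N.

Definition digits (s : 'I_(B ^ t)) : 'X_{1..t} := [multinom digit s i | i < t].

Lemma sum_digits (s : nat) n : (\sum_(i < n) digit s i * B ^ i = s %% B ^ n)%N.
Proof.
elim: n => [|n IH]; first by rewrite big_ord0 expn0 modn1.
rewrite big_ord_recr /= IH /digit.
set r := (s %% _)%N; set q := (s %/ _)%N.
have -> : (s = q %/ B * B ^ n.+1 + (q %% B * B ^ n + r))%N.
  have sE : s = (q * B ^ n + r)%N := divn_eq s (B ^ n).
  have qE : q = (q %/ B * B + q %% B)%N := divn_eq q B.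
  by rewrite [LHS]sE [in LHS]qE expnS mulnDl mulnA addnA.
rewrite modnMDl [RHS]modn_small; first exact: addnC.
have rB : (r < B ^ n)%N by rewrite ltn_mod expn_gt0.
have qB : (q %% B < B)%N by rewrite ltn_mod.
rewrite expnS; apply: (@leq_trans ((q %% B).+1 * B ^ n)%N); last by rewrite leq_mul2r qB orbT.
by rewrite mulSn addnC ltn_add2r.
Qed.

Lemma sum_digits_small (s : 'I_(B ^ t)) : (\sum_(i < t) digits s i * B ^ i = s)%N.
Proof.
rewrite -[RHS](modn_small (ltn_ord s)) -sum_digits.
by apply: eq_bigr => i _; rewrite mnmE.
Qed.

Lemma digits_inj : injective digits.
Proof.
by move=> s r sr; apply: val_inj; rewrite /= -sum_digits_small sr sum_digits_small.
Qed.

Lemma mdeg_digits (s : 'I_(B ^ t)) : (mdeg (digits s) <= t * b)%N.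
Proof.
rewrite mdegE -[X in (_ <= X * _)%N](card_ord t) -sum_nat_const; apply: leq_sum => i _.
by rewrite mnmE -ltnS ltn_mod.
Qed.

Lemma digits_onto (m : 'X_{1..t}) : (forall i, (m i < B)%N) -> exists s, digits s = m.
Proof.
move=> mB; pose F s : {ffun 'I_t -> 'I_B} := [ffun i => inord (digits s i)].
have digitsB s i : (digits s i < B)%N by rewrite mnmE ltn_mod.
have F_inj : injective F.
  move=> s r sr; apply: digits_inj; apply/mnmP => i.
  by have /ffunP /(_ i) /(congr1 val) := sr; rewrite !ffunE /= !inordK.
have [|G FG GF] := inj_card_bij F_inj; first by rewrite card_ffun !card_ord.
exists (G [ffun i => inord (m i)]); apply/mnmP => i.
have /ffunP /(_ i) /(congr1 val) := GF [ffun i => inord (m i)].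
by rewrite !ffunE /= !inordK.
Qed.

End Digits.

Section BoxMatrix.
Variables (k : fieldType) (t b : nat).
Local Notation K := (b.+1 ^ t)%N.
Implicit Types (p : 'I_t -> k).

(** Monomials of bounded degree in each variable, rather than of bounded total
    degree, make the specialisation of [box_matrix_Vandermonde] possible. *)
Definition box_matrix p (n : 'I_K -> int) : 'M[k]_K :=
  \matrix_(s, j) \prod_i (p i ^ n j) ^+ digits s i.

Definition box_det (n : 'I_K -> nat) : {mpoly k[t]} :=
  \det (\matrix_(s, j) \prod_i 'X_i ^+ (n j * digits s i)).

Lemma meval_box_det p n : (box_det n).@[p] = \det (box_matrix p (fun j => (n j)%:Z)).
Proof.
rewrite /box_det -det_map_mx; congr (\det _); apply/matrixP => s j; rewrite !mxE.
rewrite rmorph_prod; apply: eq_bigr => i _ /=.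
by rewrite rmorphXn /= mevalXU exprM exprnP.
Qed.

(** With [B = b.+1], the monomial number [s] takes the value [q ^ s] at
    [(q, q^B, q^(B^2), ...)], because its exponents are the digits of [s]. *)
Lemma box_matrix_Vandermonde (q : k) (n : 'I_K -> nat) :
  box_matrix (fun i => q ^+ (b.+1 ^ i)) (fun j => (n j)%:Z) =
  Vandermonde K (\row_j q ^+ n j).
Proof.
apply/matrixP => s j; rewrite !mxE -exprM -(sum_digits_small s) big_distrr /=.
rewrite -prodrXr; apply: eq_bigr => i _.
by rewrite -exprnP -!exprM; congr (_ ^+ _); lia.
Qed.

End BoxMatrix.

(** Natural exponents suffice here and keep the conditions polynomial in [p];
    integer exponents are recovered in [box_matrix_unit]. *)
Definition general_position (k : fieldType) t : set ('I_t -> k) := [set p |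
  (forall i, p i != 0) /\ forall b (n : {ffun 'I_(b.+1 ^ t) -> nat}),
    injective n -> (box_det k n).@[p] != 0].

Lemma nonroot_of_unity (k : closedFieldType) m (n : 'I_m -> nat) : injective n ->
  exists q : k, q != 0 /\ injective (fun j => q ^+ n j).
Proof.
move=> n_inj.
pose P : {poly k} := 'X * \prod_(i < m) \prod_(j < m | i != j) ('X^(n i) - 'X^(n j)).
have P0 : P != 0.
  rewrite mulf_neq0 ?polyX_eq0 //; apply/prodf_neq0 => i _; apply/prodf_neq0 => j ij.
  rewrite subr_eq0; apply: contraNneq ij => /(congr1 (fun r : {poly k} => size r)).
  by rewrite !size_polyXn => -[/n_inj ->].
have [q] := closed_nonrootP P P0.
rewrite rootE hornerM hornerX mulf_eq0 negb_or => /andP[q0 Pq]; exists q; split=> // i j qij.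
apply/eqP; apply: contraNT Pq => ij; rewrite horner_prod; apply/eqP.
rewrite (bigD1 i) //= horner_prod (bigD1 j) //= hornerD hornerN !hornerXn qij subrr.
by rewrite !mul0r.
Qed.

Lemma general_position_generic (k : closedFieldType) t :
  generic (~` \bigcup_i coord_hyperplane k i) (@general_position k t).
Proof.
set X := ~` _.
have XP p : X p <-> forall i, p i != 0.
  split=> [Xp i|p0 [i _ /eqP]]; last by rewrite (negPf (p0 i)).
  by apply/eqP => pi0; apply: Xp; exists i.
split=> [p [p0 _]|]; first exact/XP.
pose Zdet (x : {b : nat & {ffun 'I_(b.+1 ^ t) -> nat}}) : set ('I_t -> k) :=
  X `&` zero_locus [set if injectiveb (tagged x) then box_det k (tagged x) else 1].
exists (fun m => if choice.unpickle m is Some x then Zdet x else X `&` zero_locus [set 1]).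
have XnotV : X `&` zero_locus [set 1] <> X.
  move=> eX; have : X (fun=> 1) by apply/XP => i; apply: oner_neq0.
  by rewrite -eX => -[_ /(_ 1 erefl)] /eqP; rewrite meval1 oner_eq0.
split=> [m|p [/XP p0 np]].
  case: (choice.unpickle m) => [[b n]|]; last by split=> //; exists [set 1].
  split; first by eexists.
  rewrite /Zdet /=; case: injectiveP => // n_inj.
  have [q [q0 q_inj]] := nonroot_of_unity k n_inj.
  pose p i := q ^+ (b.+1 ^ i); move=> eX.
  have : X p by apply/XP => i; rewrite expf_neq0.
  rewrite -eX => -[_ /(_ _ erefl)]; rewrite meval_box_det box_matrix_Vandermonde.
  rewrite det_Vandermonde; apply/eqP/prodf_neq0 => i _; apply/prodf_neq0 => j ij.
  by rewrite !mxE subr_eq0; apply: contraTneq ij => /q_inj ->; rewrite ltnn.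
have [b [n [n_inj det0]]] : exists b (n : {ffun 'I_(b.+1 ^ t) -> nat}),
    injective n /\ (box_det k n).@[p] = 0.
  apply: contrapT => none; apply: np; split=> // b n n_inj.
  by apply/eqP => det0; apply: none; exists b, n.
exists (choice.pickle (Tagged (fun b => {ffun 'I_(b.+1 ^ t) -> nat}) n)) => //.
rewrite choice.pickleK; split; first exact/XP.
by move=> _ ->; rewrite /= (introT (injectiveP _) n_inj).
Qed.

Section GeneralPosition.
Variables (k : fieldType) (t : nat) (p : 'I_t -> k).
Hypothesis genp : general_position p.

Let p0 i : p i != 0. Proof. by case: genp. Qed.

(** A common translation of the exponents multiplies the rows by nonzero scalars,
    so negative exponents are covered too. *)
Lemma box_matrix_unit b (n : 'I_(b.+1 ^ t) -> int) : injective n ->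
  box_matrix p n \in unitmx.
Proof.
move=> n_inj; pose N := (\sum_j `|n j|)%N.
have le_N j : 0 <= n j + N%:Z.
  have : (`|n j| <= N)%N by rewrite /N (bigD1 j) //= leq_addr.
  lia.
pose m := [ffun j => `|(n j + N%:Z)%R|%N] : {ffun 'I_(b.+1 ^ t) -> nat}.
have mE j : (m j)%:Z = n j + N%:Z by rewrite ffunE; have := le_N j; lia.
have m_inj : injective m.
  by move=> i j /(congr1 Posz); rewrite !mE => /addIr /n_inj.
pose w : 'rV[k]_(b.+1 ^ t) := \row_s \prod_i (p i ^+ N) ^+ digits s i.
have mulE : diag_mx w *m box_matrix p n = box_matrix p (fun j => (m j)%:Z).
  apply/matrixP => s j; rewrite mul_diag_mx !mxE -big_split /=; apply: eq_bigr => i _.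
  by rewrite -exprMn mE expfzDr // mulrC.
have det0 : \det (box_matrix p (fun j => (m j)%:Z)) != 0.
  by rewrite -meval_box_det; case: genp => _; apply.
by rewrite unitmxE unitfE; apply: contraNneq det0; rewrite -mulE det_mulmx => ->; rewrite mulr0.
Qed.

Definition box_poly b (kappa : 'rV[k]_(b.+1 ^ t)) : {mpoly k[t]} :=
  \sum_s kappa 0 s *: 'X_[digits s].

Lemma deg_box_poly b (kappa : 'rV_(b.+1 ^ t)) : deg_le (t * b) (box_poly kappa).
Proof.
apply: subspace_sum => [|s _]; first exact: deg_le_subspace.
by apply: subspaceZ; [exact: deg_le_subspace|rewrite deg_leX mdeg_digits].
Qed.

Lemma meval_box_poly b (kappa : 'rV_(b.+1 ^ t)) (n : 'I_(b.+1 ^ t) -> int) j :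
  (box_poly kappa).@[power_point p (n j)] = (kappa *m box_matrix p n) 0 j.
Proof.
rewrite mxE (raddf_sum (meval _)); apply: eq_bigr => s _ /=.
by rewrite mevalZ mevalX mxE.
Qed.

Lemma box_polyP b f : deg_le b f -> exists kappa : 'rV_(b.+1 ^ t), f = box_poly kappa.
Proof.
move=> df; exists (\row_s f@_(digits s)); apply/mpolyP => m.
rewrite /box_poly (raddf_sum (mcoeff m)) /=.
have [[s sm]|none] := pselect (exists s : 'I_(b.+1 ^ t), digits s = m).
  rewrite (bigD1 s) //= big1 => [|r rs].
    by rewrite mxE mcoeffZ mcoeffX sm eqxx mulr1 addr0.
  rewrite mcoeffZ mcoeffX -sm; case: eqP => [/digits_inj/eqP|_]; last by rewrite mulr0.
  by rewrite (negPf rs).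
rewrite big1 => [|s _].
  apply: memN_msupp_eq0; apply/negP => mf; apply: none; apply: digits_onto => i.
  apply: leq_trans df; apply: leq_ltn_trans (msize_mdeg_lt mf).
  by rewrite mdegE (bigD1 i) //= leq_addr.
by rewrite mcoeffZ mcoeffX; case: eqP => [sm|_]; [case: none; exists s|rewrite mulr0].
Qed.

Lemma interpolation b (s : seq int) (v : int -> k) : uniq s -> (size s <= b.+1 ^ t)%N ->
  exists2 h, deg_le (t * b) h & forall n, n \in s -> h.@[power_point p n] = v n.
Proof.
move=> us szs; set K := (b.+1 ^ t)%N.
pose N := (\sum_(n <- s) `|n|)%N.
have le_N n : n \in s -> (`|n| <= N)%N.
  by move=> ns; rewrite /N (bigD1_seq n) //= leq_addr.
(* the list s, completed by new integers to a list of length K *)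
pose n (j : 'I_K) : int := nth (N + j).+1%:Z s j.
have n_inj : injective n.
  move=> i j; rewrite /n; have [si|si] := ltnP i (size s); have [sj|sj] := ltnP j (size s).
  - rewrite (set_nth_default (N + j).+1%:Z) // => /eqP.
    by rewrite nth_uniq // => /eqP /val_inj.
  - rewrite [RHS]nth_default // => e; have := le_N _ (mem_nth (N + i).+1%:Z si).
    by rewrite e; lia.
  - rewrite [LHS]nth_default // => e; have := le_N _ (mem_nth (N + j).+1%:Z sj).
    by rewrite -e; lia.
  - by rewrite !nth_default // => -[] /addnI; apply: val_inj.
pose kappa := (\row_j v (n j)) *m invmx (box_matrix p n).
exists (box_poly kappa) => [|x xs]; first exact: deg_box_poly.
have xK : (index x s < K)%N by apply: leq_trans szs; rewrite index_mem.
have nx : n (Ordinal xK) = x by rewrite /n nth_index.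
by rewrite -nx meval_box_poly mulmxKV ?box_matrix_unit // mxE.
Qed.

(** The monomials of degree at most [b] in each variable have total degree at most
    [t * b], and there are at least [b.+1 ^ 2] of them as [t > 1]; this exceeds
    [t * b + t + d] as soon as [b] is large. *)
Lemma general_position_interpolating (r : nat -> int) : injective r -> (1 < t)%N ->
  interpolating (fun n => power_point p (r n)).
Proof.
move=> r_inj t1 d; exists (2 * d + t ^ 2)%N => s v us szs.
pose l := size s; pose b := ((l - d) %/ t)%N.
have tb : (t * b <= l - d)%N by rewrite mulnC leq_divM.
have lb : (l - d < t * b.+1)%N by rewrite mulnC ltn_ceil //; lia.
have lK : (l <= b.+1 ^ t)%N.
  apply: (@leq_trans (b.+1 ^ 2)%N); last by rewrite leq_pexp2l.
  rewrite -/l in szs; nia.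
pose v' x := v (nth 0%N s (index x (map r s))).
have [||h dh hE] := @interpolation b (map r s) v'; rewrite ?map_inj_uniq ?size_map //.
exists h => [|n ns]; first exact: deg_leW dh.
by rewrite hE ?map_f // /v' index_map // nth_index.
Qed.

Lemma general_position_dense (r : nat -> int) : injective r ->
  critically_dense (fun n => power_point p (r n)).
Proof.
move=> r_inj f f0; apply: contrapT => none.
have zeros m : exists j, (m <= j)%N /\ f.@[power_point p (r j)] = 0.
  apply: contrapT => nz; apply: none; exists m => j mj.
  by apply/eqP => fj; apply: nz; exists j.
have [nx nxP] := choice zeros.
(* strictly increasing indices of zeros of f; there are more of them than monomials
   available to f *)
pose e j := iter j (fun m => nx m.+1) (nx 0%N).
have e_lt : {homo e : i j / (i < j)%N}.
  apply: homo_ltn => [|j]; first exact: ltn_trans.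
  by case: (nxP (e j).+1).
have e_inj : injective e.
  by move=> i j; case: (ltngtP i j) => // /e_lt + eij; rewrite eij ltnn.
have ez j : f.@[power_point p (r (e j))] = 0.
  by case: j => [|j]; [case: (nxP 0%N)|case: (nxP (e j).+1)].
have df : deg_le (msize f) f by apply: leqnSn.
have [kappa fE] := box_polyP df.
pose n (j : 'I_((msize f).+1 ^ t)) := r (e j).
have n_inj : injective n by move=> i j /r_inj /e_inj /val_inj.
case/eqP: f0; have kappa0 : kappa = 0.
  apply: (can_inj (mulmxK (box_matrix_unit n_inj))); rewrite mul0mx; apply/rowP => j.
  by rewrite -meval_box_poly -fE ez mxE.
by rewrite fE kappa0 /box_poly big1 // => s _; rewrite mxE scale0r.
Qed.

Lemma general_position_neq1 i : p i != 1.
Proof.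
have X1 : shift_var (fun=> 1) i != 0 :> {mpoly k[t]}.
  apply/eqP => /(congr1 (meval (fun=> 0))); rewrite meval_shift_var meval0 sub0r => /eqP.
  by rewrite oppr_eq0 oner_eq0.
have Posz_inj : injective Posz by move=> m n [].
have [m0 /(_ m0 (leqnn _))] := general_position_dense Posz_inj X1.
by rewrite meval_shift_var; apply: contraNneq => pi1; rewrite /power_point pi1 exp1rz subrr.
Qed.

End GeneralPosition.

Theorem theorem13p4 (k : closedFieldType) (t : nat) :
  ~ countable [set: k] -> (2 <= t)%N ->
  exists Y : set ('I_t -> k),
    generic (~` \bigcup_i coord_hyperplane k i) Y /\
    forall p : 'I_t -> k, Y p ->
      noetherian (subalg (range (fun i : 'I_t => eulerian_endo (p i)))).
Proof.
move=> _ t2; exists (@general_position k t); split; first exact: general_position_generic.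
move=> p genp; have p0 i : p i != 0 by case: genp.
have p1 := general_position_neq1 genp.
have Posz_inj : injective Posz by move=> m n [].
have Negz_inj : injective Negz by move=> m n [].
split.
  by apply: eulerian_left_noetherian => //;
    [apply: general_position_interpolating|apply: general_position_dense].
by apply: eulerian_right_noetherian => //;
  [apply: general_position_interpolating|apply: general_position_dense].
Qed.
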